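(* Let $\zeta\in\mathbb R$ and consider the Hamiltonian system $\dot q=\partial_pH$, $\dot p=-\partial_qH$ with $$H(q,p)=\tfrac12(1+q^2)p^2+\tfrac12\left(q^2-\tfrac\zeta2\right)^2 .$$ (i) (Josephson tunneling and nonlinear beating orbits.) Suppose either $\zeta>0$ and $q_0>\sqrt\zeta$ (orbits exterior to the separatrix), or $\zeta<0$ and $q_0>0$. Set $$\omega=\sqrt{q_0^2-\frac{\zeta}{2}},\qquad k^2=\frac{(1+\zeta-q_0^2)\,q_0^2}{2q_0^2-\zeta}.$$ Then the solution with initial condition $(q(0),p(0))=(q_0,0)$ has $$q(\tau)=\frac{q_0\,\mathrm{cn}(\omega\tau,k)}{\sqrt{1+q_0^2\,\mathrm{sn}^2(\omega\tau,k)}},\qquad p=\frac{\dot q}{1+q^2},$$ and it is periodic with period $$T=\frac{4K(k)}{\omega}=\frac4\omega\,K\!\left(q_0\sqrt{\frac{1+\zeta-q_0^2}{2q_0^2-\zeta}}\right).$$ For fixed $\zeta$ (with $\zeta>0$), $T$ is a decreasing function of $q_0$ for $q_0>\sqrt\zeta$. (ii) (Self-trapping orbits.) Let $\zeta>0$. The periodic orbits encircling only one fixed point are of the form $$q(\tau)=\pm\frac{q_0\,\mathrm{dn}(\omega\tau,k)}{\sqrt{1+q_0^2k^2\,\mathrm{sn}^2(\omega\tau,k)}},$$ with $$\sqrt{\zeta/2}<q_0<\sqrt\zeta,\qquad \omega^2=\frac{(1+\zeta-q_0^2)\,q_0^2}{2},\qquad k^2=\frac{2q_0^2-\zeta}{q_0^2(1+\zeta-q_0^2)},$$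 and they have period $T=2K(k)/\omega$.
   Context: The dot denotes $d/d\tau$. When $\zeta>0$ the system has three fixed points on $p=0$: a saddle at $q=0$ and centers at $q=\pm\sqrt{\zeta/2}$; the separatrix is the level set of $H$ through the saddle. $F(\mu,k)=\int_0^\mu\frac{dt}{\sqrt{1-k^2\sin^2t}}$ ($0\le k<1$) is the incomplete elliptic integral of the first kind, and $K(k)=F(\pi/2,k)$ is the complete one. The Jacobi elliptic functions with modulus $k$ are defined by $\mathrm{sn}(z,k)=\sin\delta$, $\mathrm{cn}(z,k)=\cos\delta$, $\mathrm{dn}(z,k)=\sqrt{1-k^2\sin^2\delta}$, where $z=F(\delta,k)$.
   Formalization: The printed frequencies are too small by a factor √2 for the given H (compare q''(0)); the formal statement uses ω=√(2q0²−ζ) in (i) and ω²=(1+ζ−q0²)q0² in (ii), with everything else as printed. *)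

(* Defs.v *)
From Stdlib Require Import Reals ClassicalEpsilon.
From Coquelicot Require Import Coquelicot.
Open Scope R_scope.

(** The modulus [k] is a complex number because it is allowed to be purely
    imaginary ([k^2 < 0]) as well as real.  In both cases [k^2] is real, and
    [Re] below only inverts the embedding of R into C.  The integrals converge
    for every amplitude when [k^2 < 1]. *)
Definition ellF (mu : R) (k : C) : R :=
  RInt (fun t => / sqrt (1 - Re (k * k)%C * sin t ^ 2)) 0 mu.

Definition ellK (k : C) : R := ellF (PI / 2) k.

(** The amplitude: the angle [d] with [F(d, k) = z].  For [k^2 < 1] the
    function [F(., k)] is an increasing bijection of R, so this angle exists
    and is unique. *)
Definition am (z : R) (k : C) : R :=
  epsilon (inhabits 0) (fun d => ellF d k = z).

Definition sn (z : R) (k : C) : R := sin (am z k).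
Definition cn (z : R) (k : C) : R := cos (am z k).
Definition dn (z : R) (k : C) : R :=
  sqrt (1 - Re (k * k)%C * sin (am z k) ^ 2).

(** Principal complex square root of a real number: [sqrt] vanishes on
    negative arguments, so this is [sqrt x] or [i * sqrt (- x)]. *)
Definition csqrt (x : R) : C := (sqrt x, sqrt (- x)).

Definition ham (zeta q p : R) : R :=
  / 2 * (1 + q ^ 2) * p ^ 2 + / 2 * (q ^ 2 - zeta / 2) ^ 2.

Definition dHdq (zeta q p : R) : R := Derive (fun x => ham zeta x p) q.
Definition dHdp (zeta q p : R) : R := Derive (fun y => ham zeta q y) p.

Definition solution (zeta : R) (q p : R -> R) : Prop :=
  forall t : R,
    is_derive q t (dHdp zeta (q t) (p t)) /\
    is_derive p t (- dHdq zeta (q t) (p t)).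

Definition fixed_point (zeta : R) (x : R * R) : Prop :=
  dHdp zeta (fst x) (snd x) = 0 /\ dHdq zeta (fst x) (snd x) = 0.

Definition recurs (q p : R -> R) (T : R) : Prop :=
  0 < T /\ forall t : R, q (t + T) = q t /\ p (t + T) = p t.

Definition periodic (q p : R -> R) : Prop := exists T : R, recurs q p T.

(** The period is the least positive one. *)
Definition is_period (q p : R -> R) (T : R) : Prop :=
  recurs q p T /\ forall S : R, recurs q p S -> T <= S.

Definition orbit (q p : R -> R) (x : R * R) : Prop :=
  exists t : R, x = (q t, p t).

Definition joined_off (A : R * R -> Prop) (x y : R * R) : Prop :=
  exists c : R -> R * R,
    (forall t : R, continuous c t) /\ c 0 = x /\ c 1 = y /\
    forall t : R, 0 <= t <= 1 -> ~ A (c t).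

(** [A] encircles [x] when [x] lies in a bounded path component of the
    complement of [A]. *)
Definition encircles (A : R * R -> Prop) (x : R * R) : Prop :=
  ~ A x /\
  exists B : R, forall y : R * R,
    joined_off A x y -> Rabs (fst y) <= B /\ Rabs (snd y) <= B.

Definition encircles_only_one_fixed_point (zeta : R) (q p : R -> R) : Prop :=
  exists! x : R * R, fixed_point zeta x /\ encircles (orbit q p) x.

(** Conservation of [ham] along the solution started at [(q0, 0)] reads
    [q'^2 = (1 + q^2) (q0^2 - q^2) (q0^2 + q^2 - zeta)].
    Substituting [q = q0 cos d / sqrt (1 + q0^2 sin^2 d)] turns this into
    [d'^2 = omega^2 (1 - k^2 sin^2 d)] with [omega^2 = 2 q0^2 - zeta]. *)
Definition tunneling_frequency (zeta q0 : R) : R := sqrt (2 * q0 ^ 2 - zeta).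

Definition tunneling_period (zeta q0 : R) : R :=
  4 / tunneling_frequency zeta q0 *
  ellK (q0 * csqrt ((1 + zeta - q0 ^ 2) / (2 * q0 ^ 2 - zeta)))%C.

Definition tunneling_profile (q0 omega : R) (k : C) (t : R) : R :=
  q0 * cn (omega * t) k / sqrt (1 + q0 ^ 2 * sn (omega * t) k ^ 2).

Definition self_trapping_profile (q0 omega : R) (k : C) (t : R) : R :=
  q0 * dn (omega * t) k /
  sqrt (1 + q0 ^ 2 * Re (k * k)%C * sn (omega * t) k ^ 2).

(** The same computation with [q = q0 dn / sqrt (1 + q0^2 k^2 sn^2)] gives
    [omega^2 = (1 + zeta - q0^2) q0^2]. *)
Definition self_trapping_parameters (zeta q0 omega k : R) : Prop :=
  sqrt (zeta / 2) < q0 < sqrt zeta /\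
  0 < omega /\ omega ^ 2 = (1 + zeta - q0 ^ 2) * q0 ^ 2 /\
  0 <= k < 1 /\
  k ^ 2 = (2 * q0 ^ 2 - zeta) / (q0 ^ 2 * (1 + zeta - q0 ^ 2)).

(* Main.v *)
Require Import Defs.
From Stdlib Require Import Reals ClassicalEpsilon Lra Ranalysis5.
From Coquelicot Require Import Coquelicot.
Open Scope R_scope.

(** The profiles are checked to solve the equations by differentiating the
    Jacobi functions; all other claims about a given solution follow by
    uniqueness (Gronwall on a bounded energy level).  The period is read off
    the amplitude, which advances by [PI] when its argument advances by [2 K].
    Writing the tunneling period as a single integral over [0, PI / 2], its
    integrand decreases pointwise in [q0].

    For the self-trapping orbits only the energy matters.  At energy zero, or
    on the separatrix, a periodic orbit is an equilibrium; above the separatrix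
    the segment between the fixed points avoids the orbit, so encircling one of
    them means encircling all three; in between, the orbit is a whole component
    of its level set, and the intermediate value theorem along a path replaces
    the Jordan curve theorem. *)

(** The modulus enters only through the real number k^2, and the Jacobi functions are studied under
    the single hypothesis k^2 < 1, so real and imaginary moduli need no separate treatment. Up to a
    positive factor, 1 - k^2 is (1 + q0^2) (q0^2 - zeta) for the tunneling family and (1 + q0^2)
    (zeta - q0^2) for the self-trapping family. When zeta > 0 the value q0^2 = zeta, which has the
    energy zeta^2 / 8 of the saddle, is therefore where one family ends and the other begins.

    Since [am] is obtained by choice, all its properties are transported from [ellF], which is odd,
    expanding and onto. The vector field is cubic, hence only locally Lipschitz; energy conservation
    supplies the box on which a uniform constant exists.

    A self-trapping level set consists of two mirror images. The sign [s] selects the half with s q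
    > 0, and the symmetry (q, p) -> (- q, - p) lets one argument serve both wells. *)

(** * Monotonicity and constancy from the derivative *)

Lemma nondecreasing_of_derive (f df : R -> R) :
  (forall x, is_derive f x (df x)) -> (forall x, 0 <= df x) ->
  forall a b, a <= b -> f a <= f b.
Proof.
  intros Hf Hp a b Hab.
  destruct (MVT_gen f a b df) as [c [_ Hc]].
  - intros; apply Hf.
  - intros x _. apply derivable_continuous_pt. exists (df x). apply is_derive_Reals, Hf.
  - specialize (Hp c). nra.
Qed.

Lemma constant_of_derive_0 (f : R -> R) :
  (forall x, is_derive f x 0) -> forall a b, f a = f b.
Proof.
  intros Hf.
  assert (H : forall a b, a <= b -> f a = f b).
  { intros a b Hab. apply Rle_antisym.
    - apply (nondecreasing_of_derive f (fun _ => 0)); auto; intros; lra.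
    - enough (- f a <= - f b) by lra.
      apply (nondecreasing_of_derive (fun x => - f x) (fun _ => 0)); auto; [|intros; lra].
      intros x. generalize (is_derive_opp f x 0 (Hf x)).
      unfold opp; simpl; rewrite Ropp_0; auto. }
  intros a b. destruct (Rle_dec a b); [auto|symmetry; apply H; lra].
Qed.

(** * Elliptic integral and amplitude *)

Lemma one_sub_msin2_pos (m x : R) : m < 1 -> 0 < 1 - m * sin x ^ 2.
Proof.
  intros Hm. generalize (sin2_cos2 x); unfold Rsqr; intros.
  destruct (Rle_dec m 0); nra.
Qed.

Lemma continuous_ellF_integrand (m x : R) :
  m < 1 -> continuous (fun t => / sqrt (1 - m * sin t ^ 2)) x.
Proof.
  intros Hm. generalize (one_sub_msin2_pos m x Hm); intros Hp.
  apply (ex_derive_continuous (V := R_NormedModule)). auto_derive.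
  generalize (sqrt_lt_R0 _ Hp); intros Hs.
  replace (1 + - (m * (sin x * (sin x * 1)))) with (1 - m * sin x ^ 2) by ring.
  repeat split; lra.
Qed.

Lemma is_derive_ellF (k : C) (x : R) : Re (k * k)%C < 1 ->
  is_derive (fun u => ellF u k) x (/ sqrt (1 - Re (k * k)%C * sin x ^ 2)).
Proof.
  intros Hm. unfold ellF.
  apply (is_derive_RInt (V := R_NormedModule)
          (fun t => / sqrt (1 - Re (k * k)%C * sin t ^ 2)) _ 0 x).
  - exists (mkposreal _ Rlt_0_1). intros y _.
    apply (@RInt_correct R_CompleteNormedModule).
    apply (@ex_RInt_continuous R_CompleteNormedModule).
    intros; now apply continuous_ellF_integrand.
  - now apply continuous_ellF_integrand.
Qed.

Lemma ellF_0 (k : C) : ellF 0 k = 0.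
Proof. apply (RInt_point (V := R_CompleteNormedModule)). Qed.

(** The integrand is at least 1 / sqrt (1 + |k^2|). This linear lower bound yields at once the
    injectivity of [ellF], its unboundedness, and a Lipschitz bound for its inverse [am]. *)
Lemma ellF_expanding (k : C) : Re (k * k)%C < 1 ->
  exists c, 0 < c /\ forall a b, a <= b -> c * (b - a) <= ellF b k - ellF a k.
Proof.
  intros Hm. set (m := Re (k * k)%C) in *.
  assert (Hs : 0 < sqrt (1 + Rabs m)).
  { apply sqrt_lt_R0. generalize (Rabs_pos m). lra. }
  exists (/ sqrt (1 + Rabs m)). split; [now apply Rinv_0_lt_compat|].
  intros a b Hab.
  enough (ellF a k - / sqrt (1 + Rabs m) * a <= ellF b k - / sqrt (1 + Rabs m) * b) by nra.
  apply (nondecreasing_of_derive (fun x => ellF x k - / sqrt (1 + Rabs m) * x)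
           (fun x => / sqrt (1 - m * sin x ^ 2) - / sqrt (1 + Rabs m))); auto.
  - intros x. apply (is_derive_minus (V := R_NormedModule)).
    + now apply is_derive_ellF.
    + auto_derive; auto. ring.
  - intros x. generalize (one_sub_msin2_pos m x Hm); intros Hp.
    enough (/ sqrt (1 + Rabs m) <= / sqrt (1 - m * sin x ^ 2)) by lra.
    apply Rinv_le_contravar; [now apply sqrt_lt_R0|].
    apply sqrt_le_1_alt.
    generalize (sin2_cos2 x); unfold Rsqr; intros.
    unfold Rabs; destruct (Rcase_abs m); nra.
Qed.

Lemma ellF_lt (k : C) (a b : R) : Re (k * k)%C < 1 -> a < b -> ellF a k < ellF b k.
Proof.
  intros Hm Hab. destruct (ellF_expanding k Hm) as [c [Hc H]].
  specialize (H a b (Rlt_le _ _ Hab)). nra.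
Qed.

Lemma ellF_le (k : C) (a b : R) : Re (k * k)%C < 1 -> a <= b -> ellF a k <= ellF b k.
Proof.
  intros Hm [Hab| ->]; [left; now apply ellF_lt|right; auto].
Qed.

Lemma ellF_inj (k : C) (a b : R) : Re (k * k)%C < 1 -> ellF a k = ellF b k -> a = b.
Proof.
  intros Hm H. destruct (Rtotal_order a b) as [L|[E|L]]; auto;
    apply (ellF_lt k _ _ Hm) in L; lra.
Qed.

Lemma ellF_opp (k : C) (x : R) : Re (k * k)%C < 1 -> ellF (- x) k = - ellF x k.
Proof.
  intros Hm.
  enough (ellF x k + ellF (- x) k = ellF 0 k + ellF (- 0) k) as H.
  { rewrite Ropp_0, ellF_0 in H. lra. }
  apply (constant_of_derive_0 (fun y => ellF y k + ellF (- y) k)). intros y.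
  generalize (is_derive_ellF k y Hm) (is_derive_ellF k (- y) Hm).
  rewrite sin_neg. replace ((- sin y) ^ 2) with (sin y ^ 2) by ring.
  intros H1 H2. evar_last.
  - apply (is_derive_plus (V := R_NormedModule)); [exact H1|].
    apply (is_derive_comp (fun u => ellF u k) (fun y => - y)); [exact H2|].
    auto_derive; auto.
  - unfold plus, scal, mult; simpl. unfold mult; simpl. ring.
Qed.

Lemma ellF_add_PI (k : C) (x : R) : Re (k * k)%C < 1 ->
  ellF (x + PI) k = ellF x k + 2 * ellK k.
Proof.
  intros Hm.
  assert (H : forall a b, ellF (a + PI) k - ellF a k = ellF (b + PI) k - ellF b k).
  { apply (constant_of_derive_0 (fun y => ellF (y + PI) k - ellF y k)). intros y.
    generalize (is_derive_ellF k y Hm) (is_derive_ellF k (y + PI) Hm).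
    rewrite neg_sin. replace ((- sin y) ^ 2) with (sin y ^ 2) by ring.
    intros H1 H2. evar_last.
    - apply (is_derive_minus (V := R_NormedModule)); [|exact H1].
      apply (is_derive_comp (fun u => ellF u k) (fun y => y + PI)); [exact H2|].
      auto_derive; auto.
    - unfold minus, plus, opp, scal, mult; simpl. unfold mult; simpl. ring. }
  (* The increment over a window of length PI does not depend on the window; the one centred at 0
     gives 2 K by oddness. *)
  specialize (H x (- (PI / 2))). rewrite ellF_opp in H by auto.
  replace (- (PI / 2) + PI) with (PI / 2) in H by field.
  unfold ellK. lra.
Qed.

Lemma ellK_pos (k : C) : Re (k * k)%C < 1 -> 0 < ellK k.
Proof.
  intros Hm. unfold ellK. rewrite <- (ellF_0 k). apply ellF_lt; auto.
  generalize PI_RGT_0; lra.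
Qed.

Lemma continuity_ellF (k : C) : Re (k * k)%C < 1 -> continuity (fun u => ellF u k).
Proof.
  intros Hm x. apply derivable_continuous_pt. eexists.
  apply is_derive_Reals. now apply is_derive_ellF.
Qed.

Lemma ellF_surj (k : C) (z : R) : Re (k * k)%C < 1 -> exists d, ellF d k = z.
Proof.
  intros Hm. destruct (ellF_expanding k Hm) as [c [Hc H]].
  (* With this [B] the expansion bound gives ellF B k >= |z| + 1, and oddness handles the left
     endpoint. *)
  set (B := (Rabs z + 1) / c).
  assert (HB : c * B = Rabs z + 1) by (unfold B; field; lra).
  assert (HB0 : 0 < B) by (generalize (Rabs_pos z); nra).
  generalize (H 0 B (Rlt_le _ _ HB0)). rewrite ellF_0. intros H1.
  generalize (Rle_abs z) (Rle_abs (- z)). rewrite Rabs_Ropp. intros H2 H3.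
  destruct (IVT (fun u => ellF u k - z) (- B) B) as [d [_ Hd]].
  - apply continuity_minus; [now apply continuity_ellF|apply continuity_const; now intros ? ?].
  - lra.
  - rewrite ellF_opp by auto. lra.
  - lra.
  - exists d. lra.
Qed.

Lemma ellF_am (k : C) (z : R) : Re (k * k)%C < 1 -> ellF (am z k) k = z.
Proof.
  intros Hm. unfold am. apply epsilon_spec. now apply ellF_surj.
Qed.

Lemma am_ellF (k : C) (d : R) : Re (k * k)%C < 1 -> am (ellF d k) k = d.
Proof.
  intros Hm. apply (ellF_inj k); auto. now apply ellF_am.
Qed.

Lemma am_0 (k : C) : Re (k * k)%C < 1 -> am 0 k = 0.
Proof. intros Hm. rewrite <- (ellF_0 k) at 1. now apply am_ellF. Qed.

Lemma am_add_2K (k : C) (z : R) : Re (k * k)%C < 1 ->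
  am (z + 2 * ellK k) k = am z k + PI.
Proof.
  intros Hm. apply (ellF_inj k); auto.
  rewrite ellF_add_PI, !ellF_am; auto.
Qed.

Lemma am_pos (k : C) (z : R) : Re (k * k)%C < 1 -> 0 < z -> 0 < am z k.
Proof.
  intros Hm Hz. destruct (Rlt_dec 0 (am z k)) as [|N]; auto.
  apply Rnot_lt_le, (ellF_le k) in N; auto. rewrite ellF_am, ellF_0 in N by auto. lra.
Qed.

(** The inverse of a map expanding by c is Lipschitz with constant 1 / c, whence the choice delta =
    c eps. Continuity has to precede differentiability, because the inverse function theorem used
    below asks for it. *)
Lemma continuity_pt_am (k : C) (z : R) : Re (k * k)%C < 1 ->
  continuity_pt (fun u => am u k) z.
Proof.
  intros Hm. destruct (ellF_expanding k Hm) as [c [Hc H]].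
  intros eps He. exists (c * eps). split; [apply Rmult_lt_0_compat; lra|].
  intros x [_ Hx]. simpl in *. unfold R_dist in *.
  assert (HL : forall u v, u <= v -> c * (v - u) <= ellF v k - ellF u k) by exact H.
  apply Rmult_lt_reg_l with c; auto. eapply Rle_lt_trans; [|apply Hx].
  rewrite <- (ellF_am k x Hm) at 2. rewrite <- (ellF_am k z Hm) at 2.
  destruct (Rle_dec (am x k) (am z k)) as [L|L].
  - rewrite Rabs_minus_sym, (Rabs_minus_sym (ellF _ _)).
    specialize (HL _ _ L). rewrite !Rabs_pos_eq; try nra.
  - specialize (HL (am z k) (am x k) ltac:(lra)). rewrite !Rabs_pos_eq; try nra.
Qed.

Lemma am_le (k : C) (y z : R) : Re (k * k)%C < 1 -> y <= z -> am y k <= am z k.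
Proof.
  intros Hm Hz. destruct (Rle_dec (am y k) (am z k)) as [|N]; auto.
  apply Rnot_le_lt, (ellF_lt k) in N; auto. rewrite !ellF_am in N by auto. lra.
Qed.

Lemma is_derive_am (k : C) (z : R) : Re (k * k)%C < 1 ->
  is_derive (fun u => am u k) z (sqrt (1 - Re (k * k)%C * sin (am z k) ^ 2)).
Proof.
  intros Hm. apply is_derive_Reals.
  generalize (sqrt_lt_R0 _ (one_sub_msin2_pos _ (am z k) Hm)); intros Hs.
  assert (P : forall a, am (z - 1) k <= a <= am (z + 1) k ->
                derivable_pt (fun u => ellF u k) a).
  { intros a _. eexists. now apply is_derive_Reals, is_derive_ellF. }
  assert (I : am (z - 1) k <= am z k <= am (z + 1) k) by (split; apply am_le; auto; lra).
  assert (Q : derive_pt _ _ (P (am z k) I) = / sqrt (1 - Re (k * k)%C * sin (am z k) ^ 2)).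
  { now apply derive_pt_eq_0, is_derive_Reals, is_derive_ellF. }
  replace (sqrt _) with (1 / derive_pt _ _ (P (am z k) I)) by (rewrite Q; field; lra).
  apply derivable_pt_lim_recip_interv; try lra.
  - now apply continuity_pt_am.
  - intros x _. unfold comp, id. now apply ellF_am.
  - rewrite Q. apply Rinv_neq_0_compat. lra.
Qed.

(** The sine has no zero strictly between 0 and PI, and amplitude PI is reached at 2 K. This is the
    minimality half of the self-trapping period; the next lemma plays the same part for
    tunneling. *)
Lemma am_ge_of_sin_0 (k : C) (z : R) : Re (k * k)%C < 1 -> 0 < z ->
  sin (am z k) = 0 -> 2 * ellK k <= z.
Proof.
  intros Hm Hz Hs. generalize (am_pos k z Hm Hz); intros Hp.
  destruct (Rlt_dec (am z k) PI) as [L|L].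
  - generalize (sin_gt_0 _ Hp L). lra.
  - rewrite <- (ellF_am k z Hm).
    replace (2 * ellK k) with (ellF PI k).
    + apply ellF_le; auto; lra.
    + rewrite <- (Rplus_0_l PI), ellF_add_PI, ellF_0; auto; ring.
Qed.

Lemma am_ge_of_cos_1 (k : C) (z : R) : Re (k * k)%C < 1 -> 0 < z ->
  cos (am z k) = 1 -> 4 * ellK k <= z.
Proof.
  intros Hm Hz Hs. generalize (am_pos k z Hm Hz); intros Hp.
  destruct (Rlt_dec (am z k) (2 * PI)) as [L|L].
  (* The half angle lies in (0, PI), so cos = 1 - 2 sin^2 of the half angle is strictly below 1. *)
  - assert (0 < sin (am z k / 2)) by (apply sin_gt_0; lra).
    replace (am z k) with (2 * (am z k / 2)) in Hs by field.
    rewrite cos_2a_sin in Hs. nra.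
  - rewrite <- (ellF_am k z Hm).
    replace (4 * ellK k) with (ellF (PI + PI) k).
    + apply ellF_le; auto; lra.
    + rewrite ellF_add_PI by auto.
      rewrite <- (Rplus_0_l PI), ellF_add_PI, ellF_0; auto; ring.
Qed.

(** * The Hamiltonian flow *)

Lemma dHdp_eq (zeta q p : R) : dHdp zeta q p = (1 + q ^ 2) * p.
Proof.
  unfold dHdp, ham. apply is_derive_unique. auto_derive; auto. field.
Qed.

Lemma dHdq_eq (zeta q p : R) : dHdq zeta q p = q * (p ^ 2 + 2 * q ^ 2 - zeta).
Proof.
  unfold dHdq, ham. apply is_derive_unique. auto_derive; auto. field.
Qed.

Lemma is_derive_fst_solution (zeta : R) (q p : R -> R) (t : R) :
  solution zeta q p -> is_derive q t ((1 + q t ^ 2) * p t).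
Proof. intros H. rewrite <- (dHdp_eq zeta). apply H. Qed.

Lemma is_derive_snd_solution (zeta : R) (q p : R -> R) (t : R) :
  solution zeta q p -> is_derive p t (- (q t * (p t ^ 2 + 2 * q t ^ 2 - zeta))).
Proof. intros H. rewrite <- dHdq_eq. apply H. Qed.

Lemma ham_conserved (zeta : R) (q p : R -> R) (s t : R) :
  solution zeta q p -> ham zeta (q s) (p s) = ham zeta (q t) (p t).
Proof.
  intros H. apply (constant_of_derive_0 (fun u => ham zeta (q u) (p u))). intros u.
  generalize (is_derive_fst_solution _ _ _ u H) (is_derive_snd_solution _ _ _ u H).
  intros Hq Hp. unfold ham. auto_derive.
  - repeat split; auto; eexists; eassumption.
  - rewrite (is_derive_unique (fun x : R => q x) u _ Hq), (is_derive_unique (fun x : R => p x) u _ Hp). field.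
Qed.

Lemma solution_shift (zeta : R) (q p : R -> R) (s : R) :
  solution zeta q p -> solution zeta (fun t => q (s + t)) (fun t => p (s + t)).
Proof.
  intros H t. destruct (H (s + t)) as [Hq Hp]. split.
  - evar_last; [apply (is_derive_comp q (fun t => s + t)); [exact Hq|auto_derive; auto]|].
    unfold scal; simpl; unfold mult; simpl; ring.
  - evar_last; [apply (is_derive_comp p (fun t => s + t)); [exact Hp|auto_derive; auto]|].
    unfold scal; simpl; unfold mult; simpl; ring.
Qed.

(** The bound on |D'| makes D exp (- c t) nonincreasing and D exp (c t) nondecreasing: the first
    settles t >= 0, the second t < 0. Both time directions are needed because solutions live on all
    of R. *)
Lemma gronwall_zero (D dD : R -> R) (c : R) :
  (forall t, is_derive D t (dD t)) -> (forall t, 0 <= D t) ->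
  (forall t, Rabs (dD t) <= c * D t) -> D 0 = 0 -> forall t, D t = 0.
Proof.
  intros HD Hp Hb H0 t. apply Rle_antisym; [|apply Hp].
  assert (Hd : forall u, ex_derive (fun x => D x) u) by (intros u; eexists; apply HD).
  assert (He : forall u, Derive (fun x => D x) u = dD u) by (intros u; apply is_derive_unique, HD).
  destruct (Rle_dec 0 t) as [L|L].
  - assert (- (D 0 * exp (- c * 0)) <= - (D t * exp (- c * t))).
    { apply (nondecreasing_of_derive (fun u => - (D u * exp (- c * u)))
               (fun u => (c * D u - dD u) * exp (- c * u))); auto.
      - intros u. auto_derive; [auto|]. rewrite He. ring.
      - intros u. generalize (Hb u) (Rle_abs (dD u)) (exp_pos (- c * u)). intros.
        apply Rmult_le_pos; lra. }
    generalize (exp_pos (- c * t)). rewrite H0 in H. nra.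
  - assert (D t * exp (c * t) <= D 0 * exp (c * 0)).
    { apply (nondecreasing_of_derive (fun u => D u * exp (c * u))
               (fun u => (c * D u + dD u) * exp (c * u))); try lra.
      - intros u. auto_derive; [auto|]. rewrite He. ring.
      - intros u. generalize (Hb u) (Rle_abs (- dD u)) (exp_pos (c * u)).
        rewrite Rabs_Ropp. intros. apply Rmult_le_pos; lra. }
    generalize (exp_pos (c * t)). rewrite H0 in H. nra.
Qed.

Lemma ham_sublevel_bounded (zeta E q p : R) : ham zeta q p <= E ->
  Rabs q <= 1 + Rabs zeta + 2 * E /\ Rabs p <= 1 + Rabs zeta + 2 * E.
Proof.
  unfold ham. intros H.
  generalize (pow2_ge_0 p) (pow2_ge_0 q) (pow2_ge_0 (q ^ 2 - zeta / 2)); intros P Q U.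
  assert (W : 0 <= q ^ 2 * p ^ 2) by (now apply Rmult_le_pos).
  assert (Hp : p ^ 2 <= 2 * E) by lra.
  assert (Hq : (q ^ 2 - zeta / 2) ^ 2 <= 2 * E) by lra.
  (* With w = q^2 - zeta / 2, the square (w - 1)^2 >= 0 bounds w by (w^2 + 1) / 2. The resulting
     bound on q^2 is at least 1, so it also bounds |q| and no square root appears. *)
  generalize (Rle_abs zeta) (Rabs_pos zeta) (pow2_ge_0 (q ^ 2 - zeta / 2 - 1)); intros.
  assert (q ^ 2 <= 1 + Rabs zeta + 2 * E) by lra.
  split; apply Rabs_le; split; nra.
Qed.

(** Inside the absolute value stands the time derivative of the squared distance between two
    solutions. It is a quadratic form in the differences x and y whose coefficients are dominated by
    [L] on the box; with 2 |x y| <= x^2 + y^2 this gives a bound by 3 L, rounded up to 4 L. *)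
Lemma field_lipschitz (zeta M q1 p1 q2 p2 : R) :
  Rabs q1 <= M -> Rabs p1 <= M -> Rabs q2 <= M -> Rabs p2 <= M ->
  Rabs (2 * (q1 - q2) * ((1 + q1 ^ 2) * p1 - (1 + q2 ^ 2) * p2)
        + 2 * (p1 - p2) * (- (q1 * (p1 ^ 2 + 2 * q1 ^ 2 - zeta))
                           - - (q2 * (p2 ^ 2 + 2 * q2 ^ 2 - zeta))))
  <= 4 * (1 + 7 * M ^ 2 + Rabs zeta) * ((q1 - q2) ^ 2 + (p1 - p2) ^ 2).
Proof.
  intros A1 A2 A3 A4. set (L := 1 + 7 * M ^ 2 + Rabs zeta).
  set (x := q1 - q2). set (y := p1 - p2).
  replace (2 * x * ((1 + q1 ^ 2) * p1 - (1 + q2 ^ 2) * p2)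
        + 2 * y * (- (q1 * (p1 ^ 2 + 2 * q1 ^ 2 - zeta))
                   - - (q2 * (p2 ^ 2 + 2 * q2 ^ 2 - zeta))))
    with (2 * (p2 * (q1 + q2)) * x ^ 2
          + 2 * ((1 + q1 ^ 2) - p1 ^ 2 - 2 * (q1 ^ 2 + q1 * q2 + q2 ^ 2) + zeta) * (x * y)
          - 2 * (q2 * (p1 + p2)) * y ^ 2) by (unfold x, y; ring).
  apply Rabs_le_between in A1. apply Rabs_le_between in A2.
  apply Rabs_le_between in A3. apply Rabs_le_between in A4.
  assert (Hz : - Rabs zeta <= zeta <= Rabs zeta) by (apply Rabs_le_between; lra).
  generalize (Rabs_pos zeta); intros Hz0.
  assert (M0 : 0 <= M) by lra.
  assert (B : forall u v, - M <= u <= M -> - M <= v <= M -> - M ^ 2 <= u * v <= M ^ 2).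
  { intros u v Hu Hv. split; nra. }
  assert (S : forall u, - M <= u <= M -> 0 <= u ^ 2 <= M ^ 2) by (intros; nra).
  assert (C1 : - L <= p2 * (q1 + q2) <= L).
  { generalize (B p2 q1 A4 A1) (B p2 q2 A4 A3). unfold L. nra. }
  assert (C3 : - L <= q2 * (p1 + p2) <= L).
  { generalize (B q2 p1 A3 A2) (B q2 p2 A3 A4). unfold L. nra. }
  assert (C2 : - L <= (1 + q1 ^ 2) - p1 ^ 2 - 2 * (q1 ^ 2 + q1 * q2 + q2 ^ 2) + zeta <= L).
  { generalize (B q1 q2 A1 A3) (S _ A1) (S _ A2) (S _ A3). unfold L. nra. }
  revert C1 C2 C3.
  generalize (p2 * (q1 + q2)) (q2 * (p1 + p2))
    ((1 + q1 ^ 2) - p1 ^ 2 - 2 * (q1 ^ 2 + q1 * q2 + q2 ^ 2) + zeta).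
  generalize L x y. clear. intros L x y a c b Ha Hb Hc.
  assert (X : 0 <= x ^ 2) by nra. assert (Y : 0 <= y ^ 2) by nra.
  assert (B : forall u v w, - L <= u <= L -> - w <= v <= w -> - (L * w) <= u * v <= L * w).
  { intros u v w Hu Hv. split.
    - assert (0 <= (L - u) * (w - v)) by (apply Rmult_le_pos; lra).
      assert (0 <= (L + u) * (w + v)) by (apply Rmult_le_pos; lra). lra.
    - assert (0 <= (L - u) * (w + v)) by (apply Rmult_le_pos; lra).
      assert (0 <= (L + u) * (w - v)) by (apply Rmult_le_pos; lra). lra. }
  assert (V : - (x ^ 2 + y ^ 2) <= 2 * (x * y) <= x ^ 2 + y ^ 2).
  { generalize (pow2_ge_0 (x + y)) (pow2_ge_0 (x - y)). lra. }
  generalize (B b _ _ Hb V) (B a (x ^ 2) (x ^ 2) Ha ltac:(lra))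
    (B c (y ^ 2) (y ^ 2) Hc ltac:(lra)); intros.
  apply Rabs_le. split; lra.
Qed.

Lemma solution_unique (zeta : R) (q1 p1 q2 p2 : R -> R) :
  solution zeta q1 p1 -> solution zeta q2 p2 -> q1 0 = q2 0 -> p1 0 = p2 0 ->
  forall t, q1 t = q2 t /\ p1 t = p2 t.
Proof.
  intros H1 H2 Eq Ep t.
  set (M := 1 + Rabs zeta + 2 * ham zeta (q1 0) (p1 0)).
  assert (B1 : forall u, Rabs (q1 u) <= M /\ Rabs (p1 u) <= M).
  { intros u. apply ham_sublevel_bounded. right. now apply ham_conserved. }
  assert (B2 : forall u, Rabs (q2 u) <= M /\ Rabs (p2 u) <= M).
  { intros u. unfold M; rewrite Eq, Ep. apply ham_sublevel_bounded. right.
    now apply ham_conserved. }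
  enough (H : (q1 t - q2 t) ^ 2 + (p1 t - p2 t) ^ 2 = 0).
  { rewrite <- !Rsqr_pow2 in H. apply Rplus_sqr_eq_0 in H. split; lra. }
  revert t.
  apply (gronwall_zero (fun t => (q1 t - q2 t) ^ 2 + (p1 t - p2 t) ^ 2)
    (fun t => 2 * (q1 t - q2 t) * ((1 + q1 t ^ 2) * p1 t - (1 + q2 t ^ 2) * p2 t)
        + 2 * (p1 t - p2 t) * (- (q1 t * (p1 t ^ 2 + 2 * q1 t ^ 2 - zeta))
                           - - (q2 t * (p2 t ^ 2 + 2 * q2 t ^ 2 - zeta))))
    (4 * (1 + 7 * M ^ 2 + Rabs zeta))).
  - intros t.
    generalize (is_derive_fst_solution _ _ _ t H1) (is_derive_snd_solution _ _ _ t H1)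
      (is_derive_fst_solution _ _ _ t H2) (is_derive_snd_solution _ _ _ t H2).
    intros D1 D2 D3 D4. auto_derive.
    + repeat split; eexists; eassumption.
    + rewrite (is_derive_unique (fun x : R => q1 x) t _ D1), (is_derive_unique (fun x : R => p1 x) t _ D2),
       (is_derive_unique (fun x : R => q2 x) t _ D3), (is_derive_unique (fun x : R => p2 x) t _ D4). ring.
  - intros t. generalize (pow2_ge_0 (q1 t - q2 t)) (pow2_ge_0 (p1 t - p2 t)). lra.
  - intros t. apply field_lipschitz; apply B1 || apply B2.
  - rewrite Eq, Ep. ring.
Qed.

(** * Jacobi functions and the explicit solutions *)

Lemma one_add_mul_sqr_pos (a x : R) : 0 <= a -> 0 < 1 + a * x ^ 2.
Proof.
  intros Ha. generalize (Rmult_le_pos _ _ Ha (pow2_ge_0 x)). lra.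
Qed.

Lemma is_derive_Rmult (f g : R -> R) (t df dg : R) :
  is_derive f t df -> is_derive g t dg ->
  is_derive (fun u => f u * g u) t (df * g t + f t * dg).
Proof. intros Hf Hg. apply (is_derive_mult f g); auto. intros; apply Rmult_comm. Qed.

Lemma is_derive_am_scaled (k : C) (omega t : R) : Re (k * k)%C < 1 ->
  is_derive (fun u => am (omega * u) k) t (omega * dn (omega * t) k).
Proof.
  intros Hm. apply (is_derive_comp (fun u => am u k) (fun u => omega * u)).
  - now apply is_derive_am.
  - auto_derive; auto. ring.
Qed.

Lemma is_derive_sn (k : C) (omega t : R) : Re (k * k)%C < 1 ->
  is_derive (fun u => sn (omega * u) k) t (omega * cn (omega * t) k * dn (omega * t) k).
Proof.
  intros Hm. generalize (is_derive_am_scaled k omega t Hm); intros D.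
  evar_last; [exact (is_derive_comp sin _ t _ _ (is_derive_sin _) D)|].
  unfold scal; simpl; unfold mult; simpl; unfold cn; ring.
Qed.

Lemma is_derive_cn (k : C) (omega t : R) : Re (k * k)%C < 1 ->
  is_derive (fun u => cn (omega * u) k) t (- omega * sn (omega * t) k * dn (omega * t) k).
Proof.
  intros Hm. generalize (is_derive_am_scaled k omega t Hm); intros D.
  evar_last; [exact (is_derive_comp cos _ t _ _ (is_derive_cos _) D)|].
  unfold scal; simpl; unfold mult; simpl; unfold sn; ring.
Qed.

Lemma dn_pos (k : C) (z : R) : Re (k * k)%C < 1 -> 0 < dn z k.
Proof. intros Hm. now apply sqrt_lt_R0, one_sub_msin2_pos. Qed.

Lemma dn_sqr (k : C) (z : R) : Re (k * k)%C < 1 ->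
  dn z k ^ 2 = 1 - Re (k * k)%C * sn z k ^ 2.
Proof. intros Hm. unfold dn. apply pow2_sqrt. left. now apply one_sub_msin2_pos. Qed.

Lemma cn_sqr (k : C) (z : R) : cn z k ^ 2 = 1 - sn z k ^ 2.
Proof. unfold cn, sn. generalize (sin2_cos2 (am z k)). unfold Rsqr. lra. Qed.

(** Used for three values of [b]: q0^2 and q0^2 k^2 give the denominators of the two profiles, and -
    k^2 gives [dn] itself. *)
Lemma is_derive_sqrt_affine_sn (k : C) (b omega t : R) : Re (k * k)%C < 1 ->
  0 < 1 + b * sn (omega * t) k ^ 2 ->
  is_derive (fun u => sqrt (1 + b * sn (omega * u) k ^ 2)) t
    (b * omega * sn (omega * t) k * cn (omega * t) k * dn (omega * t) k
       / sqrt (1 + b * sn (omega * t) k ^ 2)).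
Proof.
  intros Hm P. generalize (is_derive_sn k omega t Hm); intros D.
  generalize (sqrt_lt_R0 _ P); intros Q.
  assert (G : is_derive (fun x => sqrt (1 + b * x ^ 2)) (sn (omega * t) k)
                (b * sn (omega * t) k / sqrt (1 + b * sn (omega * t) k ^ 2))).
  { assert (E : forall x, 1 + b * (x * (x * 1)) = 1 + b * x ^ 2) by (intros; ring).
    auto_derive; rewrite ?E; auto. field. lra. }
  evar_last; [exact (is_derive_comp (fun x => sqrt (1 + b * x ^ 2)) _ t _ _ G D)|].
  unfold scal; simpl; unfold mult; simpl. unfold Rdiv. ring.
Qed.

Lemma is_derive_dn (k : C) (omega t : R) : Re (k * k)%C < 1 ->
  is_derive (fun u => dn (omega * u) k) t
    (- Re (k * k)%C * omega * sn (omega * t) k * cn (omega * t) k).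
Proof.
  intros Hm. generalize (dn_pos k (omega * t) Hm); intros P.
  assert (E : 1 + - Re (k * k)%C * sn (omega * t) k ^ 2
              = 1 - Re (k * k)%C * sn (omega * t) k ^ 2) by ring.
  assert (F : sqrt (1 - Re (k * k)%C * sn (omega * t) k ^ 2) = dn (omega * t) k) by reflexivity.
  apply is_derive_ext with (fun u => sqrt (1 + - Re (k * k)%C * sn (omega * u) k ^ 2)).
  { intros u. unfold dn, sn. f_equal. ring. }
  evar_last.
  - apply is_derive_sqrt_affine_sn; auto. rewrite E. now apply one_sub_msin2_pos.
  - rewrite E, F. field. lra.
Qed.

(** This is q' / (1 + q^2) in closed form. By sn^2 + cn^2 = 1, 1 + q^2 equals (1 + q0^2) / (1 + q0^2
    sn^2), and the factor 1 + q0^2 cancels against the one in q'. *)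
Definition tunneling_momentum (q0 omega : R) (k : C) (t : R) : R :=
  - q0 * omega * sn (omega * t) k * dn (omega * t) k
  / sqrt (1 + q0 ^ 2 * sn (omega * t) k ^ 2).

(** Again q' / (1 + q^2); the same cancellation now rests on dn^2 + k^2 sn^2 = 1. *)
Definition self_trapping_momentum (q0 omega : R) (k : C) (t : R) : R :=
  - q0 * Re (k * k)%C * omega * sn (omega * t) k * cn (omega * t) k
  / sqrt (1 + q0 ^ 2 * Re (k * k)%C * sn (omega * t) k ^ 2).

Lemma tunneling_solution (zeta q0 omega : R) (k : C) :
  Re (k * k)%C < 1 -> omega ^ 2 = 2 * q0 ^ 2 - zeta ->
  omega ^ 2 * Re (k * k)%C = (1 + zeta - q0 ^ 2) * q0 ^ 2 ->
  solution zeta (tunneling_profile q0 omega k) (tunneling_momentum q0 omega k).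
Proof.
  intros Hm Ho Hk t. rewrite dHdp_eq, dHdq_eq.
  assert (P : 0 < 1 + q0 ^ 2 * sn (omega * t) k ^ 2).
  { apply one_add_mul_sqr_pos, pow2_ge_0. }
  generalize (is_derive_sn k omega t Hm) (is_derive_cn k omega t Hm)
    (is_derive_dn k omega t Hm)
    (is_derive_sqrt_affine_sn k (q0 ^ 2) omega t Hm P).
  intros DS DC DD DN.
  generalize (sqrt_lt_R0 _ P) (pow2_sqrt _ (Rlt_le _ _ P)) (dn_sqr k (omega * t) Hm)
    (cn_sqr k (omega * t)).
  intros N0 HN HD HC.
  assert (Z : zeta = 2 * q0 ^ 2 - omega ^ 2) by lra.
  unfold tunneling_profile, tunneling_momentum. split.
  - evar_last.
    { apply (is_derive_div (fun u => q0 * cn (omega * u) k)); [|exact DN|lra].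
      apply is_derive_scal, DC. }
    cbv beta. revert N0 HN HD HC.
    generalize (sqrt (1 + q0 ^ 2 * sn (omega * t) k ^ 2)).
    generalize (sn (omega * t) k)
      (cn (omega * t) k) (dn (omega * t) k).
    intros x y w n N0 HN HD HC.
    field_simplify_eq; [|lra].
    ring.
  - evar_last.
    { apply (is_derive_div (fun u => - q0 * omega * sn (omega * u) k * dn (omega * u) k));
        [|exact DN|lra].
      apply (is_derive_Rmult (fun u => - q0 * omega * sn (omega * u) k)
               (fun u => dn (omega * u) k)); [|exact DD].
      apply is_derive_scal, DS. }
    cbv beta. revert N0 HN HD HC Hk.
    generalize (sqrt (1 + q0 ^ 2 * sn (omega * t) k ^ 2)).
    generalize (sn (omega * t) k)
      (cn (omega * t) k) (dn (omega * t) k) (Re (k * k)%C).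
    intros x y w m n N0 HN HD HC Hk.
    field_simplify_eq; [|lra].
    (* Once zeta is eliminated through omega^2, the momentum equation is a polynomial identity
       modulo the relations for the squared denominator, dn^2, cn^2 and omega^2 k^2. *)
    rewrite Z in *. ring [HN HD HC Hk].
Qed.

Lemma self_trapping_solution (zeta q0 omega : R) (k : C) :
  0 <= Re (k * k)%C < 1 -> omega ^ 2 = (1 + zeta - q0 ^ 2) * q0 ^ 2 ->
  omega ^ 2 * Re (k * k)%C = 2 * q0 ^ 2 - zeta ->
  solution zeta (self_trapping_profile q0 omega k) (self_trapping_momentum q0 omega k).
Proof.
  intros [Hm0 Hm] Ho Hk t. rewrite dHdp_eq, dHdq_eq.
  assert (P : 0 < 1 + q0 ^ 2 * Re (k * k)%C * sn (omega * t) k ^ 2).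
  { apply one_add_mul_sqr_pos, Rmult_le_pos; auto. apply pow2_ge_0. }
  generalize (is_derive_sn k omega t Hm) (is_derive_cn k omega t Hm)
    (is_derive_dn k omega t Hm)
    (is_derive_sqrt_affine_sn k (q0 ^ 2 * Re (k * k)%C) omega t Hm P).
  intros DS DC DD DN.
  generalize (sqrt_lt_R0 _ P) (pow2_sqrt _ (Rlt_le _ _ P)) (dn_sqr k (omega * t) Hm)
    (cn_sqr k (omega * t)).
  intros N0 HN HD HC.
  unfold self_trapping_profile, self_trapping_momentum. split.
  - evar_last.
    { apply (is_derive_div (fun u => q0 * dn (omega * u) k)); [|exact DN|lra].
      apply is_derive_scal, DD. }
    cbv beta. revert N0 HN HD HC.
    generalize (sqrt (1 + q0 ^ 2 * Re (k * k)%C * sn (omega * t) k ^ 2)).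
    generalize (sn (omega * t) k) (cn (omega * t) k) (dn (omega * t) k) (Re (k * k)%C).
    intros x y w m n N0 HN HD HC. field_simplify_eq; [|lra].
    ring [HN HD HC].
  - evar_last.
    { apply (is_derive_div
        (fun u => - q0 * Re (k * k)%C * omega * sn (omega * u) k * cn (omega * u) k));
        [|exact DN|lra].
      apply (is_derive_Rmult (fun u => - q0 * Re (k * k)%C * omega * sn (omega * u) k)
               (fun u => cn (omega * u) k)); [|exact DC].
      apply is_derive_scal, DS. }
    cbv beta. revert N0 HN HD HC Hk.
    generalize (sqrt (1 + q0 ^ 2 * Re (k * k)%C * sn (omega * t) k ^ 2)).
    generalize (sn (omega * t) k) (cn (omega * t) k) (dn (omega * t) k) (Re (k * k)%C).
    intros x y w m n N0 HN HD HC Hk. field_simplify_eq; [|lra].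
    (* The relation [Hk] with omega^2 expanded links k^2 and q0 alone; in this form it removes the
       monomial m q0^4. *)
    assert (R : m * q0 ^ 4 = m * q0 ^ 2 * (1 + zeta) - (2 * q0 ^ 2 - zeta)).
    { rewrite <- Hk, Ho. ring. }
    ring [HN HD HC Hk R].
Qed.

Lemma solution_scal_sign (zeta s : R) (q p : R -> R) : s = 1 \/ s = -1 ->
  solution zeta q p -> solution zeta (fun t => s * q t) (fun t => s * p t).
Proof.
  intros Hs H t. rewrite dHdp_eq, dHdq_eq.
  generalize (is_derive_fst_solution _ _ _ t H) (is_derive_snd_solution _ _ _ t H).
  intros Dq Dp. split.
  - evar_last; [apply is_derive_scal, Dq|]. destruct Hs as [-> | ->]; ring.
  - evar_last; [apply is_derive_scal, Dp|]. destruct Hs as [-> | ->]; ring.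
Qed.

Lemma sn_0 (k : C) : Re (k * k)%C < 1 -> sn 0 k = 0.
Proof. intros Hm. unfold sn. rewrite am_0; auto. apply sin_0. Qed.

Lemma cn_0 (k : C) : Re (k * k)%C < 1 -> cn 0 k = 1.
Proof. intros Hm. unfold cn. rewrite am_0; auto. apply cos_0. Qed.

Lemma dn_0 (k : C) : Re (k * k)%C < 1 -> dn 0 k = 1.
Proof.
  intros Hm. unfold dn. rewrite am_0, sin_0; auto.
  replace (1 - Re (k * k)%C * 0 ^ 2) with 1 by ring. apply sqrt_1.
Qed.

Lemma sn_add_2K (k : C) (z : R) : Re (k * k)%C < 1 -> sn (z + 2 * ellK k) k = - sn z k.
Proof. intros Hm. unfold sn. rewrite am_add_2K; auto. apply neg_sin. Qed.

Lemma cn_add_2K (k : C) (z : R) : Re (k * k)%C < 1 -> cn (z + 2 * ellK k) k = - cn z k.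
Proof. intros Hm. unfold cn. rewrite am_add_2K; auto. apply neg_cos. Qed.

Lemma dn_add_2K (k : C) (z : R) : Re (k * k)%C < 1 -> dn (z + 2 * ellK k) k = dn z k.
Proof.
  intros Hm. unfold dn. fold (sn (z + 2 * ellK k) k). fold (sn z k).
  rewrite sn_add_2K; auto. f_equal. ring.
Qed.

Lemma sqrt_1_add_mul_0 (b : R) : sqrt (1 + b * 0 ^ 2) = 1.
Proof. replace (1 + b * 0 ^ 2) with 1 by ring. apply sqrt_1. Qed.

Lemma tunneling_profile_0 (q0 omega : R) (k : C) : Re (k * k)%C < 1 ->
  tunneling_profile q0 omega k 0 = q0.
Proof.
  intros Hm. unfold tunneling_profile.
  rewrite Rmult_0_r, sn_0, cn_0, sqrt_1_add_mul_0; auto. field.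
Qed.

Lemma tunneling_momentum_0 (q0 omega : R) (k : C) : Re (k * k)%C < 1 ->
  tunneling_momentum q0 omega k 0 = 0.
Proof.
  intros Hm. unfold tunneling_momentum.
  rewrite Rmult_0_r, sn_0, sqrt_1_add_mul_0; auto. field.
Qed.

Lemma self_trapping_profile_0 (q0 omega : R) (k : C) : Re (k * k)%C < 1 ->
  self_trapping_profile q0 omega k 0 = q0.
Proof.
  intros Hm. unfold self_trapping_profile.
  rewrite Rmult_0_r, sn_0, dn_0, sqrt_1_add_mul_0; auto. field.
Qed.

Lemma self_trapping_momentum_0 (q0 omega : R) (k : C) : Re (k * k)%C < 1 ->
  self_trapping_momentum q0 omega k 0 = 0.
Proof.
  intros Hm. unfold self_trapping_momentum.
  rewrite Rmult_0_r, sn_0, sqrt_1_add_mul_0; auto. field.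
Qed.

(** * Least periods of the explicit solutions *)

(** Advancing by 2 K negates both [sn] and [cn], so two such steps restore the profile. For
    minimality the q-component at time 0 suffices: q(S) = q0 forces cn to equal the denominator,
    hence sn = 0 and cn > 0, that is cn = 1. *)
Lemma tunneling_is_period (q0 omega : R) (k : C) :
  Re (k * k)%C < 1 -> 0 < q0 -> 0 < omega ->
  is_period (tunneling_profile q0 omega k) (tunneling_momentum q0 omega k)
    (4 * ellK k / omega).
Proof.
  intros Hm Hq Ho. generalize (ellK_pos k Hm); intros HK. split.
  - split; [apply Rdiv_lt_0_compat; lra|]. intros t.
    unfold tunneling_profile, tunneling_momentum.
    replace (omega * (t + 4 * ellK k / omega))
      with (omega * t + 2 * ellK k + 2 * ellK k) by (field; lra).
    rewrite !sn_add_2K, !cn_add_2K, !dn_add_2K, !Ropp_involutive; auto.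
  - intros S [HS H]. specialize (H 0). destruct H as [H _].
    rewrite Rplus_0_l, tunneling_profile_0 in H by auto.
    unfold tunneling_profile in H.
    assert (P : 0 < 1 + q0 ^ 2 * sn (omega * S) k ^ 2)
      by (apply one_add_mul_sqr_pos, pow2_ge_0).
    generalize (sqrt_lt_R0 _ P) (pow2_sqrt _ (Rlt_le _ _ P)) (cn_sqr k (omega * S)).
    intros N0 HN HC.
    assert (E : cn (omega * S) k = sqrt (1 + q0 ^ 2 * sn (omega * S) k ^ 2)).
    { apply Rmult_eq_reg_l with q0; [|lra]. rewrite <- H at 2. field. lra. }
    assert (Z : (1 + q0 ^ 2) * sn (omega * S) k ^ 2 = 0).
    { rewrite <- E in HN. lra. }
    assert (Z' : sn (omega * S) k ^ 2 = 0).
    { generalize (pow2_ge_0 q0). intros. apply Rmult_integral in Z. lra. }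
    rewrite Z' in HC, HN. rewrite <- E in N0.
    assert (C1 : cos (am (omega * S) k) = 1) by (fold (cn (omega * S) k); nra).
    apply (am_ge_of_cos_1 k) in C1; auto; [|now apply Rmult_lt_0_compat].
    apply Rmult_le_reg_l with omega; auto.
    replace (omega * (4 * ellK k / omega)) with (4 * ellK k) by (field; lra). lra.
Qed.

(** Only [dn], sn^2 and the product sn cn occur, and these already return after 2 K. Minimality
    needs k^2 > 0: the condition q(S) = q0 reads (1 + q0^2) k^2 sn^2 = 0, and for k = 0 the profile
    would be constant. *)
Lemma self_trapping_is_period (q0 omega s : R) (k : C) :
  0 < Re (k * k)%C < 1 -> 0 < q0 -> 0 < omega -> s = 1 \/ s = -1 ->
  is_period (fun t => s * self_trapping_profile q0 omega k t)
    (fun t => s * self_trapping_momentum q0 omega k t) (2 * ellK k / omega).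
Proof.
  intros [Hm0 Hm] Hq Ho Hs. generalize (ellK_pos k Hm); intros HK. split.
  - split; [apply Rdiv_lt_0_compat; lra|]. intros t.
    unfold self_trapping_profile, self_trapping_momentum.
    replace (omega * (t + 2 * ellK k / omega))
      with (omega * t + 2 * ellK k) by (field; lra).
    rewrite !sn_add_2K, !cn_add_2K, !dn_add_2K; auto.
    replace ((- sn (omega * t) k) ^ 2) with (sn (omega * t) k ^ 2) by ring.
    split; auto. f_equal. f_equal. ring.
  - intros S [HS H]. specialize (H 0). destruct H as [H _].
    rewrite Rplus_0_l, self_trapping_profile_0 in H by auto.
    apply Rmult_eq_reg_l in H; [|lra].
    unfold self_trapping_profile in H.
    assert (P : 0 < 1 + q0 ^ 2 * Re (k * k)%C * sn (omega * S) k ^ 2).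
    { apply one_add_mul_sqr_pos, Rmult_le_pos; [apply pow2_ge_0|lra]. }
    generalize (sqrt_lt_R0 _ P) (pow2_sqrt _ (Rlt_le _ _ P)) (dn_sqr k (omega * S) Hm).
    intros N0 HN HD.
    assert (E : dn (omega * S) k
                = sqrt (1 + q0 ^ 2 * Re (k * k)%C * sn (omega * S) k ^ 2)).
    { apply Rmult_eq_reg_l with q0; [|lra]. rewrite <- H at 2. field. lra. }
    assert (Z : ((1 + q0 ^ 2) * Re (k * k)%C) * sn (omega * S) k ^ 2 = 0).
    { rewrite <- E in HN. lra. }
    assert (C1 : sin (am (omega * S) k) = 0).
    { fold (sn (omega * S) k). generalize (pow2_ge_0 q0). intros.
      apply Rmult_integral in Z. destruct Z as [Z|Z]; [nra|].
      apply Rsqr_0_uniq. rewrite Rsqr_pow2. exact Z. }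
    apply (am_ge_of_sin_0 k) in C1; auto; [|now apply Rmult_lt_0_compat].
    apply Rmult_le_reg_l with omega; auto.
    replace (omega * (2 * ellK k / omega)) with (2 * ellK k) by (field; lra). lra.
Qed.

Lemma is_period_ext (q p q' p' : R -> R) (T : R) :
  (forall t, q t = q' t /\ p t = p' t) -> is_period q p T -> is_period q' p' T.
Proof.
  intros E [[HT H] Hmin]. split; [split; auto|].
  - intros t. destruct (E t) as [<- <-]. destruct (E (t + T)) as [<- <-]. apply H.
  - intros S [HS H']. apply Hmin. split; auto.
    intros t. destruct (E t) as [-> ->]. destruct (E (t + S)) as [-> ->]. apply H'.
Qed.

Lemma recurs_shift (q p : R -> R) (s T : R) :
  recurs q p T <-> recurs (fun t => q (s + t)) (fun t => p (s + t)) T.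
Proof.
  split; intros [HT H]; split; auto; intros t.
  - rewrite <- Rplus_assoc. apply H.
  - specialize (H (t - s)).
    replace (s + (t - s + T)) with (t + T) in H by ring.
    replace (s + (t - s)) with t in H by ring. exact H.
Qed.

Lemma is_period_unshift (q p : R -> R) (s T : R) :
  is_period (fun t => q (s + t)) (fun t => p (s + t)) T -> is_period q p T.
Proof.
  intros [H Hmin]. split.
  - now apply (recurs_shift q p s).
  - intros S HS. apply Hmin. now apply (recurs_shift q p s).
Qed.

(** * Tunneling orbits and their period *)

(** Reconciles an arbitrary square root [k] of k^2 with the principal one used in
    [tunneling_period]. *)
Lemma ellK_ext (k k' : C) : Re (k * k)%C = Re (k' * k')%C -> ellK k = ellK k'.
Proof. intros E. unfold ellK, ellF. now rewrite E. Qed.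

Lemma Re_sqr_csqrt (x : R) : Re (csqrt x * csqrt x)%C = x.
Proof.
  unfold csqrt; simpl. destruct (Rle_dec 0 x) as [L|L].
  - rewrite (sqrt_neg_0 (- x)) by lra. rewrite sqrt_sqrt; lra.
  - rewrite (sqrt_neg_0 x) by lra. rewrite sqrt_sqrt; lra.
Qed.

Lemma Re_sqr_scal_csqrt (q x : R) :
  Re ((q * csqrt x) * (q * csqrt x))%C = x * q ^ 2.
Proof.
  rewrite <- (Re_sqr_csqrt x) at 3. simpl. ring.
Qed.

(** Both regimes amount to q0 > 0 and zeta < q0^2, from which everything else follows. *)
Lemma tunneling_range (zeta q0 : R) :
  (0 < zeta /\ sqrt zeta < q0) \/ (zeta < 0 /\ 0 < q0) ->
  0 < q0 /\ 0 < 2 * q0 ^ 2 - zeta /\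
  (1 + zeta - q0 ^ 2) * q0 ^ 2 / (2 * q0 ^ 2 - zeta) < 1.
Proof.
  intros H.
  assert (A : 0 < q0 /\ zeta < q0 ^ 2).
  { destruct H as [[Hz H]|[Hz H]].
    - generalize (sqrt_pos zeta) (pow2_sqrt zeta (Rlt_le _ _ Hz)). intros. split; nra.
    - split; nra. }
  destruct A as [Hq Hz]. assert (W : 0 < 2 * q0 ^ 2 - zeta) by nra.
  repeat split; auto.
  apply Rmult_lt_reg_r with (2 * q0 ^ 2 - zeta); auto.
  replace ((1 + zeta - q0 ^ 2) * q0 ^ 2 / (2 * q0 ^ 2 - zeta) * (2 * q0 ^ 2 - zeta))
    with ((1 + zeta - q0 ^ 2) * q0 ^ 2) by (field; lra).
  assert (0 < (q0 ^ 2 + 1) * (q0 ^ 2 - zeta)).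
  { apply Rmult_lt_0_compat; [|lra]. generalize (pow2_ge_0 q0); lra. }
  lra.
Qed.

Lemma tunneling_orbits (zeta q0 omega : R) (k : C) :
  (0 < zeta /\ sqrt zeta < q0) \/ (zeta < 0 /\ 0 < q0) ->
  omega = tunneling_frequency zeta q0 ->
  (k * k)%C = RtoC ((1 + zeta - q0 ^ 2) * q0 ^ 2 / (2 * q0 ^ 2 - zeta)) ->
  (exists q p : R -> R, solution zeta q p /\ q 0 = q0 /\ p 0 = 0) /\
  (forall q p : R -> R,
     solution zeta q p -> q 0 = q0 -> p 0 = 0 ->
     (forall t : R,
        q t = tunneling_profile q0 omega k t /\
        p t = Derive q t / (1 + q t ^ 2)) /\
     is_period q p (4 * ellK k / omega)) /\
  4 * ellK k / omega = tunneling_period zeta q0.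
Proof.
  intros Hr -> Hk. destruct (tunneling_range _ _ Hr) as [Hq [HW Hm]].
  assert (Hm' : Re (k * k)%C = (1 + zeta - q0 ^ 2) * q0 ^ 2 / (2 * q0 ^ 2 - zeta))
    by now rewrite Hk.
  rewrite <- Hm' in Hm.
  assert (Ho : 0 < tunneling_frequency zeta q0) by now apply sqrt_lt_R0.
  assert (Ho2 : tunneling_frequency zeta q0 ^ 2 = 2 * q0 ^ 2 - zeta)
    by (apply pow2_sqrt; lra).
  assert (HS : solution zeta (tunneling_profile q0 (tunneling_frequency zeta q0) k)
     (tunneling_momentum q0 (tunneling_frequency zeta q0) k)).
  { apply tunneling_solution; auto. rewrite Ho2, Hm'. field. lra. }
  split; [|split].
  - eexists _, _. split; [exact HS|]. split.
    + now apply tunneling_profile_0.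
    + now apply tunneling_momentum_0.
  - intros q p H Hq0 Hp0.
    assert (E : forall t, q t = tunneling_profile q0 (tunneling_frequency zeta q0) k t /\
                  p t = tunneling_momentum q0 (tunneling_frequency zeta q0) k t).
    { apply (solution_unique zeta _ _ _ _ H HS).
      - now rewrite tunneling_profile_0.
      - now rewrite tunneling_momentum_0. }
    split.
    + intros t. split; [apply E|].
      replace (Derive q t) with ((1 + q t ^ 2) * p t).
      * field. generalize (pow2_ge_0 (q t)); lra.
      * symmetry. apply is_derive_unique. exact (is_derive_fst_solution zeta q p t H).
    + eapply is_period_ext; [|now apply (tunneling_is_period q0)].
      intros t. split; symmetry; apply E.
  - unfold tunneling_period.
    rewrite (ellK_ext k (q0 * csqrt ((1 + zeta - q0 ^ 2) / (2 * q0 ^ 2 - zeta)))%C).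
    + field. lra.
    + rewrite Re_sqr_scal_csqrt, Hm'. field. lra.
Qed.

Lemma tunneling_period_eq_RInt (zeta q0 : R) :
  (0 < zeta /\ sqrt zeta < q0) \/ (zeta < 0 /\ 0 < q0) ->
  tunneling_period zeta q0 =
  4 * RInt (fun t => / sqrt (2 * q0 ^ 2 - zeta - (1 + zeta - q0 ^ 2) * q0 ^ 2 * sin t ^ 2))
        0 (PI / 2).
Proof.
  intros Hr. destruct (tunneling_range _ _ Hr) as [Hq [HW Hm]].
  unfold tunneling_period, ellK, ellF, tunneling_frequency.
  rewrite Re_sqr_scal_csqrt.
  replace ((1 + zeta - q0 ^ 2) / (2 * q0 ^ 2 - zeta) * q0 ^ 2)
    with ((1 + zeta - q0 ^ 2) * q0 ^ 2 / (2 * q0 ^ 2 - zeta)) by (field; lra).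
  set (m := (1 + zeta - q0 ^ 2) * q0 ^ 2 / (2 * q0 ^ 2 - zeta)) in *.
  unfold Rdiv at 1. rewrite Rmult_assoc. f_equal.
  change (scal (/ sqrt (2 * q0 ^ 2 - zeta))
    (RInt (fun t => / sqrt (1 - m * sin t ^ 2)) 0 (PI / 2)) = RInt (fun t =>
    / sqrt (2 * q0 ^ 2 - zeta - (1 + zeta - q0 ^ 2) * q0 ^ 2 * sin t ^ 2)) 0 (PI / 2)).
  rewrite <- (RInt_scal (V := R_CompleteNormedModule)).
  - apply RInt_ext. intros t _. unfold scal; simpl; unfold mult; simpl.
    rewrite <- Rinv_mult, <- sqrt_mult_alt by lra. f_equal. f_equal.
    unfold m. field. lra.
  - apply (@ex_RInt_continuous R_CompleteNormedModule).
    intros; now apply continuous_ellF_integrand.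
Qed.

Lemma tunneling_radicand_pos (zeta q0 t : R) :
  (0 < zeta /\ sqrt zeta < q0) \/ (zeta < 0 /\ 0 < q0) ->
  0 < 2 * q0 ^ 2 - zeta - (1 + zeta - q0 ^ 2) * q0 ^ 2 * sin t ^ 2.
Proof.
  intros Hr. destruct (tunneling_range _ _ Hr) as [Hq [HW Hm]].
  replace (2 * q0 ^ 2 - zeta - (1 + zeta - q0 ^ 2) * q0 ^ 2 * sin t ^ 2)
    with ((2 * q0 ^ 2 - zeta) *
      (1 - (1 + zeta - q0 ^ 2) * q0 ^ 2 / (2 * q0 ^ 2 - zeta) * sin t ^ 2)) by (field; lra).
  apply Rmult_lt_0_compat; auto. now apply one_sub_msin2_pos.
Qed.

Lemma tunneling_period_decreasing (zeta q1 q2 : R) : 0 < zeta ->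
  sqrt zeta < q1 -> q1 < q2 -> tunneling_period zeta q2 < tunneling_period zeta q1.
Proof.
  intros Hz H1 H12.
  assert (R1 : (0 < zeta /\ sqrt zeta < q1) \/ (zeta < 0 /\ 0 < q1)) by (left; lra).
  assert (R2 : (0 < zeta /\ sqrt zeta < q2) \/ (zeta < 0 /\ 0 < q2)) by (left; lra).
  rewrite !tunneling_period_eq_RInt by auto.
  apply Rmult_lt_compat_l; [lra|].
  assert (Cont : forall q0 t,
    (0 < zeta /\ sqrt zeta < q0) \/ (zeta < 0 /\ 0 < q0) ->
    continuous (fun t => / sqrt (2 * q0 ^ 2 - zeta - (1 + zeta - q0 ^ 2) * q0 ^ 2 * sin t ^ 2)) t).
  { intros q0 t Hr. generalize (tunneling_radicand_pos _ _ t Hr); intros P.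
    generalize (sqrt_lt_R0 _ P); intros Q.
    apply (ex_derive_continuous (V := R_NormedModule)).
    eexists. apply is_derive_inv; [|lra].
    apply (is_derive_comp sqrt
      (fun t => 2 * q0 ^ 2 - zeta - (1 + zeta - q0 ^ 2) * q0 ^ 2 * sin t ^ 2)).
    - apply is_derive_Reals, derivable_pt_lim_sqrt. exact P.
    - auto_derive; auto. }
  apply RInt_lt; auto.
  - generalize PI_RGT_0; lra.
  - intros t Ht.
    generalize (tunneling_radicand_pos _ _ t R1) (tunneling_radicand_pos _ _ t R2).
    intros P1 P2.
    apply Rinv_lt_contravar; [apply Rmult_lt_0_compat; now apply sqrt_lt_R0|].
    apply sqrt_lt_1_alt. split; [lra|].
    generalize (sqrt_pos zeta) (pow2_sqrt zeta (Rlt_le _ _ Hz)); intros S1 S2.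
    assert (A1 : zeta < q1 ^ 2) by nra.
    assert (A2 : q1 ^ 2 < q2 ^ 2) by nra.
    assert (X : 0 <= sin t ^ 2 <= 1).
    { generalize (sin2_cos2 t) (pow2_ge_0 (sin t)) (pow2_ge_0 (cos t)).
      unfold Rsqr. lra. }
    revert A1 A2 X. generalize (q1 ^ 2) (q2 ^ 2) (sin t ^ 2). clear -Hz. intros a b x A1 A2 X.
    (* the difference of the radicands is [(b - a) * (2 - (1 + zeta - a - b) * x)] *)
    assert (0 < (b - a) * (2 - (1 + zeta - a - b) * x)).
    { apply Rmult_lt_0_compat; [lra|].
      (* Both squares exceed zeta, so the bracket is below 1 - zeta < 1, while x lies in [0, 1];
         positivity of zeta enters here. *)
      assert ((1 + zeta - a - b) * x <= 1) by nra. lra. }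
    lra.
Qed.

(** * Encircling *)

(** The concatenation is written as c1 (h1 t) + (c2 (h2 t) - y) in the vector space R * R: on each
    half one of the two paths rests at [y], so continuity follows from sums and compositions without
    gluing. *)
Lemma joined_off_trans (A : R * R -> Prop) (x y z : R * R) :
  joined_off A x y -> joined_off A y z -> joined_off A x z.
Proof.
  intros [c1 [C1 [c10 [c11 H1]]]] [c2 [C2 [c20 [c21 H2]]]].
  (* The clamped parameters are [min (2 t) 1] and [max (2 t - 1) 0]. *)
  set (h1 := fun t => t + / 2 - Rabs (t - / 2)).
  set (h2 := fun t => t - / 2 + Rabs (t - / 2)).
  assert (E1 : forall t, t <= / 2 -> h1 t = 2 * t /\ h2 t = 0).
  { intros t Ht. unfold h1, h2. rewrite Rabs_left1 by lra. split; field. }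
  assert (E2 : forall t, / 2 <= t -> h1 t = 1 /\ h2 t = 2 * t - 1).
  { intros t Ht. unfold h1, h2. rewrite Rabs_pos_eq by lra. split; field. }
  assert (Ch : forall t, continuous h1 t /\ continuous h2 t).
  { assert (Ca : forall t, continuous (fun t => Rabs (t - / 2)) t).
    { intros t. apply (continuous_comp (fun t => t - / 2) Rabs).
      - apply (ex_derive_continuous (V := R_NormedModule)). auto_derive; auto.
      - apply continuous_Rabs. }
    intros t; split.
    - apply (continuous_minus (V := R_NormedModule) (fun t => t + / 2)); [|apply Ca].
      apply (ex_derive_continuous (V := R_NormedModule)). auto_derive; auto.
    - apply (continuous_plus (V := R_NormedModule) (fun t => t - / 2)); [|apply Ca].
      apply (ex_derive_continuous (V := R_NormedModule)). auto_derive; auto. }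
  assert (K : forall (u v : R * R), plus u (minus v v) = u).
  { intros [u1 u2] [v1 v2]. unfold minus, plus, opp; simpl. unfold prod_plus, prod_opp; simpl.
    unfold plus, opp; simpl. f_equal; ring. }
  assert (K' : forall (u v : R * R), plus v (minus u v) = u).
  { intros [u1 u2] [v1 v2]. unfold minus, plus, opp; simpl. unfold prod_plus, prod_opp; simpl.
    unfold plus, opp; simpl. f_equal; ring. }
  assert (F1 : forall t, t <= / 2 -> plus (c1 (h1 t)) (minus (c2 (h2 t)) y) = c1 (2 * t)).
  { intros t Ht. destruct (E1 t Ht) as [-> ->]. rewrite c20. apply K. }
  assert (F2 : forall t, / 2 <= t ->
    plus (c1 (h1 t)) (minus (c2 (h2 t)) y) = c2 (2 * t - 1)).
  { intros t Ht. destruct (E2 t Ht) as [-> ->]. rewrite c11. apply K'. }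
  exists (fun t => plus (c1 (h1 t)) (minus (c2 (h2 t)) y)).
  repeat split.
  - intros t. destruct (Ch t) as [D1 D2].
    apply (continuous_plus (V := prod_NormedModule R_AbsRing R_NormedModule R_NormedModule)).
    + apply (continuous_comp h1 c1); auto.
    + apply (continuous_minus (V := prod_NormedModule R_AbsRing R_NormedModule R_NormedModule)).
      * apply (continuous_comp h2 c2); auto.
      * apply continuous_const.
  - rewrite F1 by lra. rewrite Rmult_0_r. exact c10.
  - rewrite F2 by lra. rewrite <- c21. f_equal. ring.
  - intros t Ht. destruct (Rle_dec t (/ 2)).
    + rewrite F1 by lra. apply H1. lra.
    + rewrite F2 by lra. apply H2. lra.
Qed.

Lemma joined_off_segment (A : R * R -> Prop) (x1 x2 y1 y2 : R) :
  (forall t, 0 <= t <= 1 -> ~ A (x1 + t * (y1 - x1), x2 + t * (y2 - x2))) ->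
  joined_off A (x1, x2) (y1, y2).
Proof.
  intros H. exists (fun t => (x1 + t * (y1 - x1), x2 + t * (y2 - x2))).
  repeat split; auto; try (f_equal; ring).
  intros t. apply (continuous_comp_2 (fun t => x1 + t * (y1 - x1))
    (fun t => x2 + t * (y2 - x2)) (fun a b => (a, b))).
  - apply (ex_derive_continuous (V := R_NormedModule)). auto_derive; auto.
  - apply (ex_derive_continuous (V := R_NormedModule)). auto_derive; auto.
  - apply (continuous_ext (fun u : R * R => u)); [now intros []|apply continuous_id].
Qed.

Lemma encircles_joined (A : R * R -> Prop) (x y : R * R) :
  joined_off A x y -> encircles A x -> encircles A y.
Proof.
  intros J [Hx [B HB]]. split.
  - destruct J as [c [_ [_ [<- H]]]]. apply H. lra.
  - exists B. intros z Hz. apply HB. now apply joined_off_trans with y.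
Qed.

(** A vertical line that misses [A] leads from the point to arbitrary heights, so its component is
    unbounded. *)
Lemma not_encircles_vertical (A : R * R -> Prop) (a b : R) :
  (forall y, ~ A (a, y)) -> ~ encircles A (a, b).
Proof.
  intros H [_ [B HB]]. destruct (HB (a, Rabs B + 1)) as [_ HB'].
  - apply joined_off_segment. intros t _.
    replace (a + t * (a - a)) with a by ring. apply H.
  - simpl in HB'. generalize (Rle_abs B) (Rabs_pos B). intros.
    rewrite Rabs_pos_eq in HB' by lra. lra.
Qed.

(** The vertical line through the point could meet [A] only at the point itself, which an encircled
    point excludes. Applied to orbits with p = 0 throughout. *)
Lemma not_encircles_of_snd_0 (A : R * R -> Prop) (a : R) :
  (forall x y, A (x, y) -> y = 0) -> ~ encircles A (a, 0).
Proof.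
  intros H He. apply (not_encircles_vertical A a 0); auto.
  intros y Hy. destruct He as [He _]. apply He.
  now rewrite <- (H _ _ Hy).
Qed.

Lemma fixed_point_iff (zeta x y : R) :
  fixed_point zeta (x, y) <-> y = 0 /\ (x = 0 \/ x ^ 2 = zeta / 2).
Proof.
  unfold fixed_point; simpl fst; simpl snd. rewrite dHdp_eq, dHdq_eq. split.
  - intros [H1 H2]. assert (Hy : y = 0).
    { apply Rmult_integral in H1. generalize (pow2_ge_0 x). lra. }
    split; auto. subst y. apply Rmult_integral in H2. destruct H2; [left|right]; lra.
  - intros [-> [-> | H]]; split; try ring. rewrite H. field.
Qed.

Lemma orbit_ham (zeta : R) (q p : R -> R) (x y : R) :
  solution zeta q p -> orbit q p (x, y) -> ham zeta x y = ham zeta (q 0) (p 0).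
Proof. intros H [t Ht]. injection Ht as -> ->. now apply ham_conserved. Qed.

Lemma exterior_encircles_all_fixed_points (zeta E : R) (A : R * R -> Prop) (x y : R * R) :
  (forall u v, A (u, v) -> ham zeta u v = E) -> zeta ^ 2 / 8 < E -> 0 < zeta ->
  fixed_point zeta x -> fixed_point zeta y -> encircles A x -> encircles A y.
Proof.
  intros HA HE Hz. destruct x as [x1 x2], y as [y1 y2]. rewrite !fixed_point_iff.
  intros [-> Hx] [-> Hy]. apply encircles_joined, joined_off_segment.
  intros t Ht Ha. apply HA in Ha. replace (0 + t * (0 - 0)) with 0 in Ha by ring.
  assert (Bx : x1 ^ 2 <= zeta / 2) by (destruct Hx as [-> | ->]; lra).
  assert (By : y1 ^ 2 <= zeta / 2) by (destruct Hy as [-> | ->]; lra).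
  set (u := x1 + t * (y1 - x1)) in *.
  assert (Bu : 0 <= u ^ 2 <= zeta / 2).
  { split; [apply pow2_ge_0|].
    (* This product is the gap in the convexity inequality for the square. *)
    assert (0 <= t * (1 - t) * (x1 - y1) ^ 2).
    { apply Rmult_le_pos; [|apply pow2_ge_0]. apply Rmult_le_pos; lra. }
    assert (0 <= t * (zeta / 2 - y1 ^ 2)) by (apply Rmult_le_pos; lra).
    assert (0 <= (1 - t) * (zeta / 2 - x1 ^ 2)) by (apply Rmult_le_pos; lra).
    unfold u. lra. }
  unfold ham in Ha.
  (* Half of this product is zeta^2 / 8 minus the energy at (u, 0): the segment stays at or below
     the saddle energy. *)
  assert (0 <= u ^ 2 * (zeta - u ^ 2)) by (apply Rmult_le_pos; lra).
  lra.
Qed.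

(** * Self-trapping orbits *)

Lemma self_trapping_bounds (zeta q0 omega k : R) : 0 < zeta ->
  self_trapping_parameters zeta q0 omega k ->
  0 < q0 /\ zeta / 2 < q0 ^ 2 < zeta /\ 0 < omega /\
  Re (RtoC k * RtoC k)%C = k ^ 2 /\ 0 < k ^ 2 < 1 /\
  omega ^ 2 = (1 + zeta - q0 ^ 2) * q0 ^ 2 /\ omega ^ 2 * k ^ 2 = 2 * q0 ^ 2 - zeta.
Proof.
  intros Hz [[H1 H2] [H3 [H4 [H5 H6]]]].
  generalize (sqrt_lt_R0 (zeta / 2) ltac:(lra)) (pow2_sqrt (zeta / 2) ltac:(lra))
    (sqrt_pos zeta) (pow2_sqrt zeta ltac:(lra)). intros S1 S2 S3 S4.
  assert (Hq : 0 < q0) by lra.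
  assert (A : zeta / 2 < q0 ^ 2 < zeta) by (split; nra).
  assert (P : 0 < q0 ^ 2 * (1 + zeta - q0 ^ 2)) by (apply Rmult_lt_0_compat; lra).
  assert (K : 0 < k ^ 2) by (rewrite H6; apply Rdiv_lt_0_compat; lra).
  assert (K1 : k ^ 2 < 1) by nra.
  assert (Ek : Re (RtoC k * RtoC k)%C = k ^ 2) by (simpl; ring).
  repeat split; try tauto.
  rewrite H4, H6. field. lra.
Qed.

Lemma am_opp (k : C) (z : R) : Re (k * k)%C < 1 -> am (- z) k = - am z k.
Proof.
  intros Hm. apply (ellF_inj k); auto. rewrite ellF_opp, !ellF_am; auto.
Qed.

Lemma self_trapping_profile_opp (q0 omega t : R) (k : C) : Re (k * k)%C < 1 ->
  self_trapping_profile q0 omega k (- t) = self_trapping_profile q0 omega k t.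
Proof.
  intros Hm. unfold self_trapping_profile, dn, sn.
  replace (omega * - t) with (- (omega * t)) by ring.
  rewrite am_opp, sin_neg by auto.
  now replace ((- sin (am (omega * t) k)) ^ 2) with (sin (am (omega * t) k) ^ 2) by ring.
Qed.

Lemma self_trapping_momentum_opp (q0 omega t : R) (k : C) : Re (k * k)%C < 1 ->
  self_trapping_momentum q0 omega k (- t) = - self_trapping_momentum q0 omega k t.
Proof.
  intros Hm. unfold self_trapping_momentum, cn, sn.
  replace (omega * - t) with (- (omega * t)) by ring.
  rewrite am_opp, sin_neg, cos_neg by auto.
  replace ((- sin (am (omega * t) k)) ^ 2) with (sin (am (omega * t) k) ^ 2) by ring.
  unfold Rdiv. ring.
Qed.

Lemma self_trapping_profile_pos (q0 omega t : R) (k : C) : 0 <= Re (k * k)%C < 1 ->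
  0 < q0 -> 0 < self_trapping_profile q0 omega k t.
Proof.
  intros [Hm0 Hm] Hq. unfold self_trapping_profile. apply Rdiv_lt_0_compat.
  - apply Rmult_lt_0_compat; auto. now apply dn_pos.
  - apply sqrt_lt_R0, one_add_mul_sqr_pos, Rmult_le_pos; auto. apply pow2_ge_0.
Qed.

Lemma self_trapping_params_solution (zeta q0 omega k s : R) : 0 < zeta ->
  self_trapping_parameters zeta q0 omega k -> s = 1 \/ s = -1 ->
  solution zeta (fun t => s * self_trapping_profile q0 omega (RtoC k) t)
    (fun t => s * self_trapping_momentum q0 omega (RtoC k) t).
Proof.
  intros Hz H Hs. destruct (self_trapping_bounds _ _ _ _ Hz H) as (A & B & D & E & F & G & I).
  apply solution_scal_sign; auto. apply self_trapping_solution; rewrite ?E; auto; lra.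
Qed.

Lemma self_trapping_ham (zeta q0 omega k t : R) : 0 < zeta ->
  self_trapping_parameters zeta q0 omega k ->
  ham zeta (self_trapping_profile q0 omega (RtoC k) t)
    (self_trapping_momentum q0 omega (RtoC k) t) = ham zeta q0 0.
Proof.
  intros Hz H. destruct (self_trapping_bounds _ _ _ _ Hz H) as (A & B & D & E & F & G & I).
  assert (S : solution zeta (self_trapping_profile q0 omega (RtoC k))
    (self_trapping_momentum q0 omega (RtoC k)))
    by (apply self_trapping_solution; rewrite ?E; auto; lra).
  rewrite (ham_conserved zeta _ _ t 0 S).
  rewrite self_trapping_profile_0, self_trapping_momentum_0; auto; rewrite E; lra.
Qed.

Lemma ham_opp (zeta s x y : R) : s = 1 \/ s = -1 -> ham zeta (s * x) (s * y) = ham zeta x y.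
Proof. intros [-> | ->]; unfold ham; ring. Qed.

Lemma self_trapping_profile_hits (zeta q0 omega k u : R) : 0 < zeta ->
  self_trapping_parameters zeta q0 omega k -> 0 < u -> zeta - q0 ^ 2 <= u ^ 2 <= q0 ^ 2 ->
  exists t, self_trapping_profile q0 omega (RtoC k) t = u.
Proof.
  intros Hz H Hu0 Hu. destruct (self_trapping_bounds _ _ _ _ Hz H) as (A & B & D & E & F & G & I).
  assert (W : 0 < (1 + zeta - q0 ^ 2) * q0 ^ 2) by (apply Rmult_lt_0_compat; lra).
  assert (Ek : k ^ 2 = (2 * q0 ^ 2 - zeta) / ((1 + zeta - q0 ^ 2) * q0 ^ 2)).
  { rewrite <- I, G. field. split; lra. }
  (* [X] is the value of [sn^2] at which the profile equals [u]. *)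
  set (X := (q0 ^ 2 - u ^ 2) * (1 + zeta - q0 ^ 2) / ((2 * q0 ^ 2 - zeta) * (1 + u ^ 2))).
  assert (V : 0 < (2 * q0 ^ 2 - zeta) * (1 + u ^ 2)) by (apply Rmult_lt_0_compat; lra).
  assert (X0 : 0 <= X).
  { apply Rmult_le_pos; [apply Rmult_le_pos; lra|]. left. now apply Rinv_0_lt_compat. }
  assert (X1 : X <= 1).
  { apply Rmult_le_reg_r with ((2 * q0 ^ 2 - zeta) * (1 + u ^ 2)); auto.
    replace (X * ((2 * q0 ^ 2 - zeta) * (1 + u ^ 2)))
      with ((q0 ^ 2 - u ^ 2) * (1 + zeta - q0 ^ 2)) by (unfold X; field; lra).
    (* The gap in X <= 1 factors this way: X is 0 at u^2 = q0^2 and 1 at the inner turning point u^2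
       = zeta - q0^2. *)
    assert (0 <= (1 + q0 ^ 2) * (u ^ 2 - (zeta - q0 ^ 2))) by (apply Rmult_le_pos; lra).
    lra. }
  assert (Y : -1 <= sqrt X <= 1).
  { generalize (sqrt_pos X). split; [lra|]. rewrite <- sqrt_1. now apply sqrt_le_1_alt. }
  exists (ellF (asin (sqrt X)) (RtoC k) / omega).
  assert (S2 : sn (omega * (ellF (asin (sqrt X)) (RtoC k) / omega)) (RtoC k) ^ 2 = X).
  { replace (omega * (ellF (asin (sqrt X)) (RtoC k) / omega))
      with (ellF (asin (sqrt X)) (RtoC k)) by (field; lra).
    unfold sn. rewrite am_ellF by (rewrite E; lra). rewrite sin_asin by auto.
    now apply pow2_sqrt. }
  set (t := ellF (asin (sqrt X)) (RtoC k) / omega) in *.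
  assert (Pp : 0 < self_trapping_profile q0 omega (RtoC k) t)
    by (apply self_trapping_profile_pos; rewrite ?E; lra).
  apply Rsqr_inj; try lra. rewrite !Rsqr_pow2.
  assert (N : 0 < 1 + q0 ^ 2 * Re (RtoC k * RtoC k)%C * sn (omega * t) (RtoC k) ^ 2).
  { apply one_add_mul_sqr_pos, Rmult_le_pos; [apply pow2_ge_0|rewrite E; lra]. }
  unfold self_trapping_profile, Rdiv. rewrite !Rpow_mult_distr, pow_inv.
  rewrite dn_sqr by (rewrite E; lra). rewrite pow2_sqrt by lra.
  rewrite E, S2, Ek in *. unfold X.
  field. repeat split; lra.
Qed.

(** The energy equation reads (1 + u^2) v^2 = (q0^2 - u^2) (q0^2 + u^2 - zeta). Nonnegativity of the
    right side confines u^2 to the range of the profile, and then v is determined up to sign. *)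
Lemma self_trapping_orbit_complete (zeta q0 omega k s x y : R) : 0 < zeta ->
  self_trapping_parameters zeta q0 omega k -> s = 1 \/ s = -1 ->
  ham zeta x y = ham zeta q0 0 -> 0 < s * x ->
  exists t, x = s * self_trapping_profile q0 omega (RtoC k) t /\
            y = s * self_trapping_momentum q0 omega (RtoC k) t.
Proof.
  intros Hz H Hs Hh Hx. destruct (self_trapping_bounds _ _ _ _ Hz H) as (A & B & D & E & F & G & I).
  assert (Hss : s * s = 1) by (destruct Hs as [-> | ->]; ring).
  rewrite <- (ham_opp zeta s) in Hh by auto.
  enough (exists t, s * x = self_trapping_profile q0 omega (RtoC k) t /\
            s * y = self_trapping_momentum q0 omega (RtoC k) t) as [t [H1 H2]].
  { exists t. rewrite <- H1, <- H2, <- !Rmult_assoc, Hss. lra. }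
  revert Hh Hx. generalize (s * x) (s * y). clear x y s Hs Hss. intros u v Hh Hu.
  assert (Hu2 : zeta - q0 ^ 2 <= u ^ 2 <= q0 ^ 2).
  { unfold ham in Hh.
    assert (0 <= u ^ 2 * v ^ 2) by (apply Rmult_le_pos; apply pow2_ge_0).
    assert (Pr : 0 <= (q0 ^ 2 - u ^ 2) * (q0 ^ 2 + u ^ 2 - zeta)).
    { generalize (pow2_ge_0 v). lra. }
    (* The two factors add up to 2 q0^2 - zeta > 0, so they cannot both be negative. *)
    split; apply Rnot_lt_le; intros L.
    - assert (0 < (q0 ^ 2 - u ^ 2) * (zeta - q0 ^ 2 - u ^ 2)) by (apply Rmult_lt_0_compat; lra).
      lra.
    - assert (0 < (u ^ 2 - q0 ^ 2) * (q0 ^ 2 + u ^ 2 - zeta)) by (apply Rmult_lt_0_compat; lra).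
      lra. }
  destruct (self_trapping_profile_hits _ _ _ _ u Hz H Hu Hu2) as [t Ht].
  generalize (self_trapping_ham _ _ _ _ t Hz H). rewrite Ht, <- Hh. intros Hv.
  assert (V : (v - self_trapping_momentum q0 omega (RtoC k) t) *
              (v + self_trapping_momentum q0 omega (RtoC k) t) = 0).
  { unfold ham in Hv. apply Rmult_eq_reg_l with (1 + u ^ 2).
    - lra.
    - generalize (pow2_ge_0 u). lra. }
  apply Rmult_integral in V. destruct V as [V|V].
  - exists t. rewrite Ht. split; lra.
  (* Time reversal keeps q and flips the sign of p. *)
  - exists (- t). rewrite self_trapping_profile_opp, self_trapping_momentum_opp, Ht
      by (rewrite E; lra). split; lra.
Qed.

(** The center has energy 0, so it lies in the region of energy below E with s q > 0. A path that
    avoids [A] cannot leave this region, and energy sublevels are bounded. *)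
Lemma self_trapping_encircles_center (zeta q0 omega k s : R) (A : R * R -> Prop) : 0 < zeta ->
  self_trapping_parameters zeta q0 omega k -> s = 1 \/ s = -1 ->
  (forall x y, A (x, y) <-> ham zeta x y = ham zeta q0 0 /\ 0 < s * x) ->
  encircles A (s * sqrt (zeta / 2), 0).
Proof.
  intros Hz H Hs HA. destruct (self_trapping_bounds _ _ _ _ Hz H) as (Q & B & _).
  set (E := ham zeta q0 0) in *.
  assert (HE : E = / 2 * (q0 ^ 2 - zeta / 2) ^ 2) by (unfold E, ham; ring).
  assert (HE0 : 0 < E) by (rewrite HE; nra).
  assert (HE1 : E < zeta ^ 2 / 8).
  { assert (0 < q0 ^ 2 * (zeta - q0 ^ 2)) by (apply Rmult_lt_0_compat; lra). lra. }
  assert (S2 : (s * sqrt (zeta / 2)) ^ 2 = zeta / 2).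
  { rewrite Rpow_mult_distr, pow2_sqrt by lra. destruct Hs as [-> | ->]; ring. }
  assert (Hh0 : ham zeta (s * sqrt (zeta / 2)) 0 = 0) by (unfold ham; rewrite S2; ring).
  assert (Sp : 0 < s * (s * sqrt (zeta / 2))).
  { replace (s * (s * sqrt (zeta / 2))) with (sqrt (zeta / 2))
      by (destruct Hs as [-> | ->]; ring). apply sqrt_lt_R0. lra. }
  split.
  { rewrite HA, Hh0. lra. }
  exists (1 + Rabs zeta + 2 * E).
  intros [y1 y2] (c & Cc & C0 & C1 & HcA). simpl.
  (* Folding the half plane [s x <= 0] onto the axis [x = 0], where the
     Hamiltonian exceeds [E], turns the orbit into the full zero set of [G]. *)
  set (r := fun t => (s * fst (c t) + Rabs (s * fst (c t))) / 2).
  set (G := fun t => ham zeta (r t) (snd (c t)) - E).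
  assert (Gin : forall t, G t <= 0 -> 0 < s * fst (c t) /\
                  G t = ham zeta (fst (c t)) (snd (c t)) - E).
  { intros t Ht. destruct (Rle_dec (s * fst (c t)) 0) as [L|L].
    - exfalso. assert (r t = 0) by (unfold r; rewrite Rabs_left1; lra).
      unfold G, ham in Ht. rewrite H0 in Ht.
      generalize (pow2_ge_0 (snd (c t))). lra.
    - split; [lra|]. unfold G. f_equal. rewrite <- (ham_opp zeta s (fst (c t))) by auto.
      replace (r t) with (s * fst (c t)) by (unfold r; rewrite Rabs_pos_eq; lra).
      unfold ham. destruct Hs as [-> | ->]; ring. }
  assert (Gnz : forall t, 0 <= t <= 1 -> G t <> 0).
  { intros t Ht Hg. destruct (Gin t) as [P1 P2]; [lra|].
    apply (HcA t Ht). destruct (c t) as [c1 c2]. apply HA. simpl in *. split; lra. }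
  assert (Cr : continuity r).
  { intros t. apply continuity_pt_filterlim.
    assert (Cf : continuous (fun t => s * fst (c t)) t).
    { apply (continuous_scal_r (V := R_NormedModule) s (fun t => fst (c t))).
      apply (continuous_comp c fst); [apply Cc|]. apply continuous_fst. }
    apply (continuous_mult (K := R_AbsRing)
      (fun t => s * fst (c t) + Rabs (s * fst (c t))) (fun _ => / 2)).
    - apply (continuous_plus (V := R_NormedModule)); auto.
      apply (continuous_comp _ Rabs); [exact Cf|apply continuous_Rabs].
    - apply continuous_const. }
  assert (Cs : continuity (fun t => snd (c t))).
  { intros t. apply continuity_pt_filterlim.
    apply (continuous_comp c snd); [apply Cc|]. apply continuous_snd. }
  assert (CG : continuity G).
  { assert (Cc' : forall a, continuity (fun _ : R => a))
      by (intros a; apply continuity_const; now intros ? ?).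
    assert (Cq : forall f, continuity f -> continuity (fun t => f t ^ 2)).
    { intros f Hf. apply (continuity_comp f (fun x => x ^ 2)); auto.
      apply derivable_continuous, derivable_pow. }
    unfold G, ham.
    apply continuity_minus; auto. apply continuity_plus.
    - apply continuity_mult; auto. apply continuity_mult; auto.
      apply continuity_plus; auto.
    - apply continuity_mult; auto.
      apply (Cq (fun t => r t ^ 2 - zeta / 2)). apply continuity_minus; auto. }
  assert (G0 : G 0 < 0).
  { unfold G, r. rewrite C0; simpl. rewrite Rabs_pos_eq by lra.
    replace ((s * (s * sqrt (zeta / 2)) + s * (s * sqrt (zeta / 2))) / 2)
      with (s * (s * sqrt (zeta / 2))) by field.
    unfold ham. rewrite Rpow_mult_distr, S2.
    replace (s ^ 2) with 1 by (destruct Hs as [-> | ->]; ring). lra. }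
  assert (G1 : G 1 < 0).
  { apply Rnot_le_lt. intros [L|L].
    - destruct (IVT G 0 1 CG Rlt_0_1 G0 L) as [t [Ht Hg]]. now apply (Gnz t).
    - symmetry in L. revert L. apply Gnz. lra. }
  destruct (Gin 1) as [_ P]; [lra|]. rewrite C1 in P. simpl in P.
  apply (ham_sublevel_bounded zeta). lra.
Qed.

Lemma self_trapping_orbit_iff (zeta q0 omega k s x y : R) : 0 < zeta ->
  self_trapping_parameters zeta q0 omega k -> s = 1 \/ s = -1 ->
  orbit (fun t => s * self_trapping_profile q0 omega (RtoC k) t)
    (fun t => s * self_trapping_momentum q0 omega (RtoC k) t) (x, y) <->
  ham zeta x y = ham zeta q0 0 /\ 0 < s * x.
Proof.
  intros Hz H Hs. destruct (self_trapping_bounds _ _ _ _ Hz H) as (A & B & D & E & F & _).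
  split.
  - intros [t Ht]. injection Ht as -> ->. rewrite ham_opp by auto. split.
    + eapply self_trapping_ham; eauto.
    + replace (s * (s * self_trapping_profile q0 omega (RtoC k) t))
        with (self_trapping_profile q0 omega (RtoC k) t) by (destruct Hs as [-> | ->]; ring).
      apply self_trapping_profile_pos; rewrite ?E; lra.
  - intros [Hh Hx].
    destruct (self_trapping_orbit_complete _ _ _ _ _ _ _ Hz H Hs Hh Hx) as [t [-> ->]].
    now exists t.
Qed.

Lemma self_trapping_encircles_one (zeta q0 omega k s : R) : 0 < zeta ->
  self_trapping_parameters zeta q0 omega k -> s = 1 \/ s = -1 ->
  encircles_only_one_fixed_point zeta
    (fun t => s * self_trapping_profile q0 omega (RtoC k) t)
    (fun t => s * self_trapping_momentum q0 omega (RtoC k) t).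
Proof.
  intros Hz H Hs. exists (s * sqrt (zeta / 2), 0). split; [split|].
  - apply fixed_point_iff. split; auto. right.
    rewrite Rpow_mult_distr, pow2_sqrt by lra. destruct Hs as [-> | ->]; field.
  - eapply self_trapping_encircles_center; eauto. intros x y.
    now apply self_trapping_orbit_iff.
  - intros [x y] [Hf He]. apply fixed_point_iff in Hf. destruct Hf as [-> Hx].
    (* The saddle and the opposite center lie where s x <= 0, so the vertical line through either of
       them misses the orbit. *)
    destruct (Rle_dec (s * x) 0) as [L|L].
    + exfalso. revert He. apply not_encircles_vertical. intros y.
      rewrite (self_trapping_orbit_iff zeta) by eauto. lra.
    + destruct Hx as [-> | Hx]; [lra|]. f_equal.
      assert (Q : s * x = sqrt (zeta / 2)).
      { symmetry. apply sqrt_lem_1; try lra. rewrite <- Hx.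
        destruct Hs as [-> | ->]; ring. }
      rewrite <- Q. destruct Hs as [-> | ->]; ring.
Qed.

(* On the separatrix [(p / q)' = - (p^2 + q^2)]. *)
Lemma periodic_separatrix_meets_saddle (zeta : R) (q p : R -> R) (T : R) :
  solution zeta q p -> recurs q p T -> ham zeta (q 0) (p 0) = zeta ^ 2 / 8 ->
  exists t, q t = 0.
Proof.
  intros H [HT HR] Hh. destruct (excluded_middle_informative (exists t, q t = 0)) as [|N]; auto.
  exfalso. assert (Nz : forall t, q t <> 0) by (intros t Ht; apply N; now exists t).
  assert (Hf : forall t, is_derive (fun t => p t / q t) t (- (p t ^ 2 + q t ^ 2))).
  { intros t.
    generalize (is_derive_fst_solution _ _ _ t H) (is_derive_snd_solution _ _ _ t H) (Nz t).
    intros Dq Dp Hq. evar_last; [apply (is_derive_div p q); eauto|].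
    generalize (ham_conserved _ _ _ t 0 H). rewrite Hh. unfold ham. intros E.
    assert (E' : (1 + q t ^ 2) * p t ^ 2 = zeta * q t ^ 2 - q t ^ 4) by lra.
    field_simplify_eq; auto.
    revert E'. generalize (q t) (p t). intros x y E'.
    assert (E2 : x ^ 2 * y ^ 2 = zeta * x ^ 2 - x ^ 4 - y ^ 2) by lra.
    ring [E2]. }
  (* The ratio p / q returns to its value after one period although its derivative is strictly
     negative. *)
  destruct (MVT_gen (fun t => p t / q t) 0 T (fun t => - (p t ^ 2 + q t ^ 2))) as [c [_ Hc]].
  - intros; apply Hf.
  - intros x _. apply derivable_continuous_pt. eexists. apply is_derive_Reals, Hf.
  - rewrite <- (Rplus_0_l T) in Hc at 1 2. destruct (HR 0) as [-> ->] in Hc.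
    generalize (Nz c). intros Hq. assert (0 < p c ^ 2 + q c ^ 2).
    { generalize (pow2_ge_0 (p c)) (pow2_gt_0 (q c) Hq). lra. }
    assert (0 < (p c ^ 2 + q c ^ 2) * (T - 0)) by (apply Rmult_lt_0_compat; lra).
    lra.
Qed.

Lemma zero_solution (zeta : R) : solution zeta (fun _ => 0) (fun _ => 0).
Proof.
  intros t. rewrite dHdp_eq, dHdq_eq. split.
  - evar_last; [apply is_derive_const|]. unfold zero; simpl; ring.
  - evar_last; [apply is_derive_const|]. unfold zero; simpl; ring.
Qed.

(** * Classification of the periodic orbits that encircle one fixed point *)

Lemma self_trapping_parameters_exist (zeta E : R) : 0 < E < zeta ^ 2 / 8 -> 0 < zeta ->
  exists q0 omega k, self_trapping_parameters zeta q0 omega k /\ ham zeta q0 0 = E.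
Proof.
  intros HE Hz.
  (* The outer turning point solves (q0^2 - zeta / 2)^2 = 2 E, so q0^2 = zeta / 2 + d; energy below
     zeta^2 / 8 means d < zeta / 2. *)
  set (d := sqrt (2 * E)).
  assert (d0 : 0 < d) by (apply sqrt_lt_R0; lra).
  assert (d2 : d ^ 2 = 2 * E) by (apply pow2_sqrt; lra).
  assert (d1 : d < zeta / 2) by nra.
  set (a := zeta / 2 + d).
  assert (a2 : sqrt a ^ 2 = a) by (apply pow2_sqrt; unfold a; lra).
  assert (W : 0 < (1 + zeta - a) * a) by (apply Rmult_lt_0_compat; unfold a; lra).
  assert (k0 : 0 <= (2 * a - zeta) / (a * (1 + zeta - a))).
  { apply Rlt_le, Rdiv_lt_0_compat; [unfold a|]; lra. }
  exists (sqrt a), (sqrt ((1 + zeta - a) * a)), (sqrt ((2 * a - zeta) / (a * (1 + zeta - a)))).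
  unfold self_trapping_parameters. rewrite !a2. repeat split.
  - apply sqrt_lt_1_alt. unfold a; lra.
  - apply sqrt_lt_1_alt. unfold a; lra.
  - now apply sqrt_lt_R0.
  - apply pow2_sqrt. lra.
  - apply sqrt_pos.
  - rewrite <- sqrt_1 at 2. apply sqrt_lt_1_alt. split; auto.
    apply Rmult_lt_reg_r with (a * (1 + zeta - a)); [lra|].
    replace ((2 * a - zeta) / (a * (1 + zeta - a)) * (a * (1 + zeta - a)))
      with (2 * a - zeta) by (field; split; unfold a; lra).
    assert (0 < (1 + a) * (zeta - a)) by (apply Rmult_lt_0_compat; unfold a; lra). lra.
  - now apply pow2_sqrt.
  - unfold ham. rewrite a2. unfold a. lra.
Qed.

Lemma encircling_one_energy (zeta : R) (q p : R -> R) : 0 < zeta ->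
  solution zeta q p -> periodic q p -> encircles_only_one_fixed_point zeta q p ->
  0 < ham zeta (q 0) (p 0) < zeta ^ 2 / 8.
Proof.
  intros Hz H [T HT] [[a b] [[Hf He] Hu]].
  (* Nonpositive energy and the separatrix energy will both be refuted by deriving that p vanishes
     identically. *)
  assert (NP : ~ forall t, p t = 0).
  { intros Hp. apply fixed_point_iff in Hf. destruct Hf as [-> _].
    revert He. apply not_encircles_of_snd_0.
    intros x y [t Ht]. injection Ht as _ ->. apply Hp. }
  split.
  - apply Rnot_le_lt. intros L. apply NP. intros t.
    rewrite <- (ham_conserved _ _ _ t 0 H) in L. unfold ham in L.
    assert (0 <= q t ^ 2 * p t ^ 2) by (apply Rmult_le_pos; apply pow2_ge_0).
    generalize (pow2_ge_0 (p t)) (pow2_ge_0 (q t ^ 2 - zeta / 2)). intros.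
    apply Rsqr_0_uniq. rewrite Rsqr_pow2. lra.
  - apply Rnot_le_lt. intros [L|L].
    + assert (F0 : fixed_point zeta (0, 0)) by (apply fixed_point_iff; auto).
      assert (F1 : fixed_point zeta (sqrt (zeta / 2), 0)).
      { apply fixed_point_iff. split; auto. right. apply pow2_sqrt. lra. }
      assert (X : forall y, fixed_point zeta y -> encircles (orbit q p) y).
      { intros y Hy.
        apply (exterior_encircles_all_fixed_points zeta _ _ (a, b) y
          (fun u v => orbit_ham zeta q p u v H)); auto. }
      assert (E0 := Hu _ (conj F0 (X _ F0))). assert (E1 := Hu _ (conj F1 (X _ F1))).
      rewrite E0 in E1. injection E1 as E1.
      generalize (sqrt_lt_R0 (zeta / 2) ltac:(lra)). lra.
    + destruct (periodic_separatrix_meets_saddle zeta q p T H HT (eq_sym L)) as [c Hc].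
      (* At a zero of q this energy leaves no momentum, so the orbit passes through the saddle and
         by uniqueness is the zero solution. *)
      assert (Hpc : p c = 0).
      { rewrite <- (ham_conserved _ _ _ c 0 H) in L. unfold ham in L. rewrite Hc in L.
        apply Rsqr_0_uniq. rewrite Rsqr_pow2. lra. }
      apply NP. intros t.
      destruct (solution_unique zeta _ _ _ _ (solution_shift zeta q p c H) (zero_solution zeta))
        with (t := t - c) as [_ Z]; rewrite ?Rplus_0_r; auto.
      now replace (c + (t - c)) with t in Z by ring.
Qed.

Lemma encircling_one_self_trapping (zeta : R) (q p : R -> R) : 0 < zeta ->
  solution zeta q p -> periodic q p -> encircles_only_one_fixed_point zeta q p ->
  exists q0 omega k s t0 : R,
    self_trapping_parameters zeta q0 omega k /\ (s = 1 \/ s = -1) /\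
    (forall t : R, q (t0 + t) = s * self_trapping_profile q0 omega (RtoC k) t) /\
    is_period q p (2 * ellK (RtoC k) / omega).
Proof.
  intros Hz H HP H1. generalize (encircling_one_energy zeta q p Hz H HP H1). intros HE.
  destruct (self_trapping_parameters_exist _ _ HE Hz) as (q0 & omega & k & Hpar & Hh).
  destruct (self_trapping_bounds _ _ _ _ Hz Hpar) as (A & B & D & E & F & G & I).
  (* On q = 0 the energy is at least zeta^2 / 8. Hence q 0 has a sign, which becomes [s]. *)
  assert (Nz : q 0 <> 0).
  { intros Z. rewrite Z in HE. unfold ham in HE. generalize (pow2_ge_0 (p 0)). lra. }
  assert (Hs : exists s, (s = 1 \/ s = -1) /\ 0 < s * q 0).
  { destruct (Rlt_dec 0 (q 0)); [exists 1|exists (-1)]; split; auto; lra. }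
  destruct Hs as [s [Hs Hsq]].
  destruct (self_trapping_orbit_complete zeta q0 omega k s (q 0) (p 0) Hz Hpar Hs
    (eq_sym Hh) Hsq) as [t1 [Q1 Q2]].
  assert (Sol := self_trapping_params_solution zeta q0 omega k s Hz Hpar Hs).
  (* The explicit solution passes through (q 0, p 0) at time [t1], so the given one is its
     translate; the time origin moves to the outer turning point. *)
  assert (Eq : forall t, q (- t1 + t) = s * self_trapping_profile q0 omega (RtoC k) t /\
                         p (- t1 + t) = s * self_trapping_momentum q0 omega (RtoC k) t).
  { intros t.
    generalize (solution_unique zeta q p _ _ H (solution_shift zeta _ _ t1 Sol)).
    rewrite !Rplus_0_r. intros U. destruct (U Q1 Q2 (- t1 + t)) as [-> ->].
    now replace (t1 + (- t1 + t)) with t by ring. }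
  exists q0, omega, k, s, (- t1). split; [auto|]. split; [auto|]. split; [apply Eq|].
  apply (is_period_unshift q p (- t1)).
  eapply is_period_ext; [|apply (self_trapping_is_period q0 omega s); rewrite ?E; auto].
  intros t. destruct (Eq t) as [-> ->]. auto.
Qed.

Theorem mainTheorem2 (zeta : R) :
  (forall (q0 omega : R) (k : C),
     (0 < zeta /\ sqrt zeta < q0) \/ (zeta < 0 /\ 0 < q0) ->
     omega = tunneling_frequency zeta q0 ->
     (k * k)%C = RtoC ((1 + zeta - q0 ^ 2) * q0 ^ 2 / (2 * q0 ^ 2 - zeta)) ->
     (exists q p : R -> R, solution zeta q p /\ q 0 = q0 /\ p 0 = 0) /\
     (forall q p : R -> R,
        solution zeta q p -> q 0 = q0 -> p 0 = 0 ->
        (forall t : R,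
           q t = tunneling_profile q0 omega k t /\
           p t = Derive q t / (1 + q t ^ 2)) /\
        is_period q p (4 * ellK k / omega)) /\
     4 * ellK k / omega = tunneling_period zeta q0) /\
  (0 < zeta ->
   forall q1 q2 : R, sqrt zeta < q1 -> q1 < q2 ->
     tunneling_period zeta q2 < tunneling_period zeta q1) /\
  (0 < zeta ->
   (forall q p : R -> R,
      solution zeta q p -> periodic q p ->
      encircles_only_one_fixed_point zeta q p ->
      exists q0 omega k s t0 : R,
        self_trapping_parameters zeta q0 omega k /\
        (s = 1 \/ s = -1) /\
        (forall t : R,
           q (t0 + t) = s * self_trapping_profile q0 omega (RtoC k) t) /\
        is_period q p (2 * ellK (RtoC k) / omega)) /\
   (forall q0 omega k s : R,
      self_trapping_parameters zeta q0 omega k ->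
      s = 1 \/ s = -1 ->
      exists q p : R -> R,
        solution zeta q p /\
        (forall t : R,
           q t = s * self_trapping_profile q0 omega (RtoC k) t) /\
        encircles_only_one_fixed_point zeta q p /\
        is_period q p (2 * ellK (RtoC k) / omega))).
Proof.
  split; [|split].
  - apply tunneling_orbits.
  - intros Hz q1 q2. now apply tunneling_period_decreasing.
  - intros Hz. split.
    + intros q p. now apply encircling_one_self_trapping.
    + intros q0 omega k s H Hs.
      destruct (self_trapping_bounds _ _ _ _ Hz H) as (A & B & D & E & F & _).
      exists (fun t => s * self_trapping_profile q0 omega (RtoC k) t),
        (fun t => s * self_trapping_momentum q0 omega (RtoC k) t).
      split; [now apply self_trapping_params_solution|].
      split; [auto|].
      split; [now apply self_trapping_encircles_one|].
      apply self_trapping_is_period; rewrite ?E; auto.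
Qed.
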